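(* Let $G$ be a group acting irreducibly and minimally on a simplicial tree $T$, and suppose that $G$ contains weak small cancellation elements, i.e. for every $N\ge 1$ and every $m\ge1$ there is an $m$-tuple of elements of $G$ which is weakly $N$-small cancellation with respect to this action. Then the positive theory of $G$ is trivial, i.e. $G$ satisfies exactly the same positive sentences as a non-abelian free group.
   Context: For $g$ an isometry of a tree, $tl(g)=\inf_{p} d(p,gp)$. The action of $G$ is abelian if $tl(gh)\le tl(g)+tl(h)$ for all $g,h\in G$; dihedral if it is not abelian and $tl(gh)\le tl(g)+tl(h)$ for all pairs of hyperbolic $g,h\in G$; irreducible if neither abelian nor dihedral. Minimal: no proper $G$-invariant subtree. A tuple $a=(a_1,\dots,a_m)\in G^m$ is weakly $N$-small cancellation if for some base vertex $*$: (a) $d( *,a_i* )>N$ for all $i$; (b) $d( *,a_j* )\le\frac{N+1}{N}\min_i tl(a_i)$ for all $j$; (c) for all $g\in G$ and $1\le i,j\le m$, the inequality $|[*,a_i*]\cap g[*,a_j*]|\ge\frac1N\min_i tl(a_i)$ can hold only if $i=j$, and in that case $g$ acts as the identity on $[*,a_i*]\cap g[*,a_i*]$. A positive sentence is a first-order sentence in the language of groups without negations (built from equations with $\wedge,\vee,\forall,\exists$); $G$ has trivial positive theory if the set of positive sentences true in $G$ equals that of the free group $F_2$. *)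

(* Defs.v *)
From Stdlib Require Import Reals List Bool Lia ClassicalEpsilon.
Import ListNotations.
Open Scope R_scope.

Record Group := {
  gcar :> Type;
  gmul : gcar -> gcar -> gcar;
  ginv : gcar -> gcar;
  gone : gcar;
  gmulA : forall x y z, gmul x (gmul y z) = gmul (gmul x y) z;
  gmul1 : forall x, gmul gone x = x;
  gmulV : forall x, gmul (ginv x) x = gone
}.

Record Tree := {
  vert : Type;
  adj : vert -> vert -> Prop;
  adj_sym : forall u v, adj u v -> adj v u;
  adj_irrefl : forall u, ~ adj u u
}.

Inductive Walk (T : Tree) : vert T -> vert T -> nat -> Prop :=
| wnil x : Walk T x x 0
| wcons x y z n : adj T x y -> Walk T y z n -> Walk T x z (S n).

Fixpoint chain (T : Tree) (l : list (vert T)) : Prop :=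
  match l with
  | x :: ((y :: _) as r) => adj T x y /\ chain T r
  | _ => True
  end.

Fixpoint nobacktrack (T : Tree) (l : list (vert T)) : Prop :=
  match l with
  | x :: ((_ :: z :: _) as r) => x <> z /\ nobacktrack T r
  | _ => True
  end.

Definition is_tree (T : Tree) : Prop :=
  (forall x y : vert T, exists n, Walk T x y n) /\
  (forall (x : vert T) (l : list (vert T)),
      chain T (x :: l) -> nobacktrack T (x :: l) -> last l x = x -> l = []).

Definition dist (T : Tree) (x y : vert T) : nat :=
  epsilon (inhabits 0%nat)
    (fun n => Walk T x y n /\ forall m, Walk T x y m -> (n <= m)%nat).

(* PE u v t is the point of the edge (u,v) at distance t from u (0 <= t <= 1) *)
Inductive point (T : Tree) :=
| PV : vert T -> point T
| PE : vert T -> vert T -> R -> point T.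
Arguments PV {T}. Arguments PE {T}.

Definition valid_point (T : Tree) (p : point T) : Prop :=
  match p with
  | PV _ => True
  | PE u v t => adj T u v /\ 0 <= t <= 1
  end.

Definition dV (T : Tree) (x y : vert T) : R := INR (dist T x y).

Definition ptdist (T : Tree) (p q : point T) : R :=
  match p, q with
  | PV x, PV y => dV T x y
  | PV x, PE u v t | PE u v t, PV x => Rmin (t + dV T u x) (1 - t + dV T v x)
  | PE u v t, PE u' v' t' =>
      if excluded_middle_informative (u = u' /\ v = v') then Rabs (t - t')
      else if excluded_middle_informative (u = v' /\ v = u') then Rabs (1 - t - t')
      else Rmin (Rmin (t + dV T u u' + t') (t + dV T u v' + (1 - t')))
                (Rmin ((1 - t) + dV T v u' + t') ((1 - t) + dV T v v' + (1 - t')))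
  end.

Record Action (G : Group) (T : Tree) := {
  act : G -> vert T -> vert T;
  act_one : forall v, act (gone G) v = v;
  act_mul : forall g h v, act (gmul G g h) v = act g (act h v);
  act_adj : forall g u v, adj T u v <-> adj T (act g u) (act g v)
}.
Arguments act {G T}.

Definition act_pt {G T} (A : Action G T) (g : G) (p : point T) : point T :=
  match p with
  | PV x => PV (act A g x)
  | PE u v t => PE (act A g u) (act A g v) t
  end.

Definition is_glb (E : R -> Prop) (r : R) : Prop :=
  (forall x, E x -> r <= x) /\ (forall b, (forall x, E x -> b <= x) -> b <= r).

Definition tl {G T} (A : Action G T) (g : G) : R :=
  epsilon (inhabits 0)
    (is_glb (fun r => exists p : point T, valid_point T p /\ r = ptdist T p (act_pt A g p))).

Definition hyperbolic {G T} (A : Action G T) (g : G) : Prop := 0 < tl A g.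

Definition abelian_action {G T} (A : Action G T) : Prop :=
  forall g h : G, tl A (gmul G g h) <= tl A g + tl A h.

Definition dihedral_action {G T} (A : Action G T) : Prop :=
  ~ abelian_action A /\
  forall g h : G, hyperbolic A g -> hyperbolic A h ->
    tl A (gmul G g h) <= tl A g + tl A h.

Definition irreducible_action {G T} (A : Action G T) : Prop :=
  ~ abelian_action A /\ ~ dihedral_action A.

Inductive WalkIn (T : Tree) (S : vert T -> Prop) : vert T -> vert T -> Prop :=
| winil x : S x -> WalkIn T S x x
| wicons x y z : S x -> adj T x y -> WalkIn T S y z -> WalkIn T S x z.

Definition subtree (T : Tree) (S : vert T -> Prop) : Prop :=
  (exists x, S x) /\ forall x y, S x -> S y -> WalkIn T S x y.

Definition minimal_action {G T} (A : Action G T) : Prop :=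
  forall S : vert T -> Prop,
    subtree T S -> (forall g x, S x -> S (act A g x)) -> forall x, S x.

Definition inseg (T : Tree) (x y z : vert T) : Prop :=
  (dist T x z + dist T z y)%nat = dist T x y.

Definition minR (l : list R) : R := fold_right Rmin (hd 0 l) l.

Definition weak_small_cancellation {G T} (A : Action G T) (N : nat) (a : list G) : Prop :=
  let m := length a in
  let ai i := nth i a (gone G) in
  let mt := minR (map (tl A) a) in
  exists s : vert T,
    (forall i, (i < m)%nat -> INR N < dV T s (act A (ai i) s)) /\
    (forall j, (j < m)%nat -> dV T s (act A (ai j) s) <= (INR N + 1) / INR N * mt) /\
    (forall (g : G) i j, (i < m)%nat -> (j < m)%nat ->
       let I z := inseg T s (act A (ai i) s) z /\
                  exists w, inseg T s (act A (ai j) s) w /\ z = act A g w in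
       (exists p q, I p /\ I q /\ mt / INR N <= dV T p q) ->
       i = j /\ forall z, I z -> act A g z = z).

Inductive term := tvar (n : nat) | tone | tmul (t1 t2 : term) | tinv (t : term).

Inductive pform :=
| peq (t1 t2 : term)
| pand (f1 f2 : pform)
| por (f1 f2 : pform)
| pall (n : nat) (f : pform)
| pex (n : nat) (f : pform).

Fixpoint tfree (n : nat) (t : term) : Prop :=
  match t with
  | tvar k => k = n
  | tone => False
  | tmul t1 t2 => tfree n t1 \/ tfree n t2
  | tinv t => tfree n t
  end.

Fixpoint ffree (n : nat) (f : pform) : Prop :=
  match f with
  | peq t1 t2 => tfree n t1 \/ tfree n t2
  | pand f1 f2 | por f1 f2 => ffree n f1 \/ ffree n f2
  | pall k f | pex k f => k <> n /\ ffree n f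
  end.

Definition sentence (f : pform) : Prop := forall n, ~ ffree n f.

Section Sem.
Variables (A : Type) (mul : A -> A -> A) (inv : A -> A) (one : A) (eqv : A -> A -> Prop).

Fixpoint tval (e : nat -> A) (t : term) : A :=
  match t with
  | tvar n => e n
  | tone => one
  | tmul t1 t2 => mul (tval e t1) (tval e t2)
  | tinv t => inv (tval e t)
  end.

Definition upd (e : nat -> A) (n : nat) (x : A) : nat -> A :=
  fun k => if Nat.eqb k n then x else e k.

Fixpoint sat (e : nat -> A) (f : pform) : Prop :=
  match f with
  | peq t1 t2 => eqv (tval e t1) (tval e t2)
  | pand f1 f2 => sat e f1 /\ sat e f2
  | por f1 f2 => sat e f1 \/ sat e f2
  | pall n f => forall x : A, sat (upd e n x) f
  | pex n f => exists x : A, sat (upd e n x) f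
  end.
End Sem.

Definition GHolds (G : Group) (f : pform) : Prop :=
  sat G (gmul G) (ginv G) (gone G) eq (fun _ => gone G) f.

(* The free group F_2 on generators a,b: words over letters (generator, inverted?)
   modulo free reduction; [reduce] computes the freely reduced normal form. *)
Definition letter := (bool * bool)%type.
Definition cancels (x y : letter) : bool := Bool.eqb (fst x) (fst y) && xorb (snd x) (snd y).
Definition rstep (x : letter) (acc : list letter) : list letter :=
  match acc with
  | y :: r => if cancels x y then r else x :: acc
  | [] => [x]
  end.
Definition reduce (w : list letter) : list letter := fold_right rstep [] w.
Definition F2inv (w : list letter) : list letter :=
  rev (map (fun x => (fst x, negb (snd x))) w).
Definition F2eq (u v : list letter) : Prop := reduce u = reduce v.

Definition F2Holds (f : pform) : Prop :=
  sat (list letter) (@app letter) F2inv [] F2eq (fun _ => []) f.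

Definition trivial_positive_theory (G : Group) : Prop :=
  forall f : pform, sentence f -> (GHolds G f <-> F2Holds f).

(* Main.v *)
(** A positive sentence true in a group acting on a tree with elements a, b such that the
    translates of [s, a s] and [s, b s] overlap little is true in every group H; applied to G and to the free group
    acting on its Cayley tree, this gives both implications.

    Fix G-invariant families of oriented segments ("patterns") and elements h_i of H.
    Reading the occurrences of the patterns along the geodesic [s, g s] decodes g into a
    product of the h_i and their inverses.  This is compatible with inversion, and with a
    product g h unless some pattern straddles the centre of the tripod s, g s, g h s.
    For each universal quantifier let the opponent play a G-element whose geodesic carries
    M patterns, each exactly once, all longer than anything played before.  A sentence
    involves boundedly many tripods, each spoiling boundedly many patterns per quantifier,
    so for M large an unspoiled pattern remains.  The element then decodes to u h w, and h
    can be chosen to make this any prescribed value in H; decoding the answers found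
    in G gives answers in H.

    The patterns are the stretches between consecutive copies of a in the word
    a b^n0 a b^n1 a ... a, distinguished by their lengths. *)
Require Import Defs.
From Stdlib Require Import Reals List.
From Stdlib Require Import ZArith Lia Lra Arith Classical ClassicalEpsilon.
From Stdlib Require Import FunctionalExtensionality Eqdep_dec.
Import ListNotations.
Open Scope nat_scope.

(** * Geodesics in trees *)

Lemma least_nat (P : nat -> Prop) :
  (exists n, P n) -> exists n, P n /\ forall m, P m -> n <= m.
Proof.
  intros [n0 H0].
  destruct (dec_inh_nat_subset_has_unique_least_element P) as [n [Hn _]].
  - intro n; apply classic.
  - now exists n0.
  - now exists n.
Qed.

Section TreeMetric.
Variable T : Tree.
Hypothesis HT : is_tree T.
Local Notation d := (Defs.dist T).

Lemma tdist_spec x y : Walk T x y (d x y) /\ forall m, Walk T x y m -> d x y <= m.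
Proof.
  unfold Defs.dist. apply epsilon_spec. apply least_nat. apply HT.
Qed.

Lemma walk_trans x y z m n : Walk T x y m -> Walk T y z n -> Walk T x z (m + n).
Proof. induction 1; simpl; auto. intro H1; econstructor; eauto. Qed.

Lemma walk_sym x y m : Walk T x y m -> Walk T y x m.
Proof.
  induction 1; [constructor|].
  replace (S n) with (n + 1) by lia. eapply walk_trans; [exact IHWalk|].
  econstructor; [apply adj_sym; exact H|constructor].
Qed.

Lemma tdist_refl x : d x x = 0.
Proof. assert (H := proj2 (tdist_spec x x) 0 (wnil T x)). lia. Qed.

Lemma tdist_sym x y : d x y = d y x.
Proof.
  apply Nat.le_antisymm; apply tdist_spec, walk_sym, tdist_spec.
Qed.

Lemma tdist_tri x y z : d x z <= d x y + d y z.
Proof. apply tdist_spec. eapply walk_trans; apply tdist_spec. Qed.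

Lemma tdist0_eq x y : d x y = 0 -> x = y.
Proof.
  intro H. assert (W := proj1 (tdist_spec x y)). rewrite H in W. now inversion W.
Qed.

Lemma tdist_adj x y : adj T x y -> d x y = 1.
Proof.
  intro H. assert (d x y <= 1).
  { apply tdist_spec. econstructor; [exact H|constructor]. }
  destruct (d x y) eqn:E; [|lia].
  apply tdist0_eq in E. subst. now apply adj_irrefl in H.
Qed.

Lemma step_toward x y n : d x y = S n -> exists y', adj T y y' /\ d x y' = n.
Proof.
  intro H. rewrite tdist_sym in H.
  assert (W := proj1 (tdist_spec y x)). rewrite H in W.
  inversion W as [|? y' ? ? A W']; subst.
  exists y'. split; auto.
  assert (d y' x <= n) by now apply tdist_spec.
  assert (I := tdist_tri y y' x).
  rewrite (tdist_adj _ _ A) in I. rewrite tdist_sym. lia.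
Qed.

Lemma chain_snoc l (y z : vert T) : chain T (l ++ [y]) -> adj T y z -> chain T (l ++ [y; z]).
Proof.
  induction l as [|a [|b l] IH]; simpl in *; intuition.
Qed.

Lemma nobacktrack_snoc l (x y z : vert T) :
  nobacktrack T (l ++ [x; y]) -> x <> z -> nobacktrack T (l ++ [x; y; z]).
Proof.
  induction l as [|a [|b [|c l]] IH]; simpl in *; intuition.
Qed.

(** Descend from both vertices towards [x] until the two descents meet. The second and the
    penultimate vertex are named because they are closer to [x], so the path can be prolonged
    upwards at either end without backtracking. *)
Lemma same_level_path x n : forall v v', v <> v' -> d x v = n -> d x v' = n ->
  exists p t t' w w', p = v :: w :: t /\ p = t' ++ [w'; v'] /\
    chain T p /\ nobacktrack T p /\ S (d x w) = n /\ S (d x w') = n.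
Proof.
  induction n as [|n IH]; intros v v' Hne Hv Hv'.
  { apply tdist0_eq in Hv, Hv'. congruence. }
  destruct (step_toward _ _ _ Hv) as (w & Aw & Dw).
  destruct (step_toward _ _ _ Hv') as (w' & Aw' & Dw').
  destruct (classic (w = w')) as [->|Hw].
  - exists [v; w'; v'], [v'], [v], w', w'. simpl.
    repeat split; auto using adj_sym.
  - destruct (IH w w' Hw Dw Dw') as (p & t & t' & u & u' & E1 & E2 & C & B & Du & Du').
    exists (v :: p ++ [v']), (u :: t ++ [v']), (v :: t' ++ [u']), w, w'.
    repeat split; try lia.
    + rewrite E1. reflexivity.
    + rewrite E2. simpl. now rewrite <- !app_assoc.
    + assert (chain T (p ++ [v'])).
      { rewrite E2 in *. replace (t' ++ [u'; w']) with ((t' ++ [u']) ++ [w']) in *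
          by now rewrite <- app_assoc.
        rewrite <- app_assoc. apply chain_snoc; auto using adj_sym. }
      rewrite E1 in *. simpl. simpl in H. tauto.
    + assert (nobacktrack T (p ++ [v'])).
      { rewrite E2 in *. rewrite <- app_assoc. simpl. apply nobacktrack_snoc; auto.
        intros ->. lia. }
      rewrite E1 in *. simpl. simpl in H. split; auto. intros ->. lia.
Qed.

Lemma no_closed_path x l : chain T (x :: l ++ [x]) -> nobacktrack T (x :: l ++ [x]) -> False.
Proof.
  intros C B. destruct HT as [_ H]. specialize (H x (l ++ [x]) C B).
  rewrite last_last in H. specialize (H eq_refl). now destruct l.
Qed.

(** If both ends of an edge had the same level, the path of [same_level_path] closed up by that edge
    would be a closed path without backtracking. *)
Lemma adj_level x u v : adj T u v -> d x u = S (d x v) \/ d x v = S (d x u).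
Proof.
  intro H. assert (H1 := tdist_adj _ _ H).
  assert (d x u <= d x v + d v u) by apply tdist_tri.
  assert (d x v <= d x u + d u v) by apply tdist_tri.
  rewrite (tdist_sym v u) in H0.
  destruct (Nat.eq_dec (d x u) (d x v)) as [E|]; [exfalso|lia].
  assert (Hne : u <> v) by (intros ->; now apply adj_irrefl in H).
  destruct (same_level_path x _ u v Hne E eq_refl)
    as (p & t & t' & w & w' & E1 & E2 & C & B & Dw & Dw').
  apply (no_closed_path u (w :: t)).
  - change (chain T ((u :: w :: t) ++ [u])). rewrite <- E1, E2.
    replace ((t' ++ [w'; v]) ++ [u]) with ((t' ++ [w']) ++ [v; u]) by now rewrite <- !app_assoc.
    apply chain_snoc; [|now apply adj_sym]. rewrite <- app_assoc. simpl. now rewrite <- E2.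
  - change (nobacktrack T ((u :: w :: t) ++ [u])). rewrite <- E1, E2, <- app_assoc. simpl.
    apply nobacktrack_snoc; [now rewrite <- E2|]. intros ->. lia.
Qed.

(** Two different lower neighbours would be joined by a path below [u], which closes up through [u]
    without backtracking. *)
Lemma lower_unique x u v v' :
  adj T u v -> adj T u v' -> d x u = S (d x v) -> d x u = S (d x v') -> v = v'.
Proof.
  intros A A' D D'. apply NNPP; intro Hne.
  destruct (same_level_path x (d x v) v v' Hne eq_refl ltac:(lia))
    as (p & t & t' & w & w' & E1 & E2 & C & B & Dw & Dw').
  apply (no_closed_path u p).
  - assert (H : chain T (p ++ [u])).
    { rewrite E2 in *.
      replace (t' ++ [w'; v']) with ((t' ++ [w']) ++ [v']) in * by now rewrite <- !app_assoc.
      rewrite <- app_assoc. apply chain_snoc; auto using adj_sym. }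
    rewrite E1 in *. simpl in *. tauto.
  - assert (H : nobacktrack T (p ++ [u])).
    { rewrite E2 in *. rewrite <- app_assoc. simpl. apply nobacktrack_snoc; auto.
      intros ->. lia. }
    rewrite E1 in *. simpl in *. split; auto. intros ->. lia.
Qed.

Lemma point_at x y k : k <= d x y -> exists z, inseg T x y z /\ d x z = k.
Proof.
  unfold inseg. remember (d x y) as n eqn:E. revert y E.
  induction n as [|n IH]; intros y E Hk.
  - exists y. rewrite tdist_refl. lia.
  - destruct (Nat.eq_dec k (S n)) as [->|].
    + exists y. rewrite tdist_refl. lia.
    + symmetry in E. destruct (step_toward _ _ _ E) as (y' & A & D).
      destruct (IH y') as (z & S1 & D1); try lia.
      exists z. split; auto.
      assert (d z y <= d z y' + d y' y) by apply tdist_tri.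
      assert (d x y <= d x z + d z y) by apply tdist_tri.
      rewrite (tdist_sym y' y), (tdist_adj _ _ A) in H. lia.
Qed.

(** Induction on the distance to [y]: the last steps of geodesics through [z] and through [z'] both
    come from the only neighbour of [y] closer to [x]. *)
Lemma seg_unique x y z z' : inseg T x y z -> inseg T x y z' -> d x z = d x z' -> z = z'.
Proof.
  unfold inseg. intros H H' E.
  assert (E2 : d z y = d z' y) by lia.
  remember (d z y) as n eqn:En. revert y H H' En E2.
  induction n as [|n IH]; intros y H H' En E2.
  - rewrite (tdist0_eq z y), (tdist0_eq z' y); auto.
  - destruct (step_toward z y n) as (y1 & A1 & D1); auto.
    destruct (step_toward z' y n) as (y2 & A2 & D2); auto.
    assert (d x y1 <= d x z + d z y1) by apply tdist_tri.
    assert (d x y2 <= d x z' + d z' y2) by apply tdist_tri.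
    assert (Hy : y1 = y2).
    { apply (lower_unique x y); auto;
      [destruct (adj_level x _ _ A1)|destruct (adj_level x _ _ A2)]; lia. }
    subst y2. destruct (adj_level x _ _ A1); apply (IH y1); lia.
Qed.

(** Once a geodesic moves away from [z] it keeps doing so: the only neighbour closer to [z] is the
    vertex just left. *)
Lemma increasing_ray z n : forall x x' y, adj T x x' -> d x y = S n -> d x' y = n ->
  d z x' = S (d z x) -> d z y = d z x + d x y.
Proof.
  induction n as [|n IH]; intros x x' y A D D' U.
  - apply tdist0_eq in D'. subst. lia.
  - rewrite tdist_sym in D'. destruct (step_toward _ _ _ D') as (x2 & A2 & D2).
    rewrite tdist_sym in D', D2.
    destruct (adj_level z _ _ A2) as [L|L].
    + assert (x = x2) by (apply (lower_unique z x'); auto using adj_sym).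
      subst. lia.
    + specialize (IH x' x2 y A2 D' D2 L). lia.
Qed.

(** Walk from [x] towards [y] as long as the steps approach [z]; the vertex where they stop doing so
    is the centre of the tripod. *)
Lemma median x y z : exists o, inseg T x y o /\ inseg T x z o /\ inseg T y z o.
Proof.
  unfold inseg. remember (d x y) as n eqn:E. symmetry in E. revert x E.
  induction n as [|n IH]; intros x E.
  - apply tdist0_eq in E. subst. exists y. rewrite tdist_refl. lia.
  - assert (E' := E). rewrite tdist_sym in E'.
    destruct (step_toward _ _ _ E') as (x' & A & D). rewrite tdist_sym in D.
    destruct (adj_level z _ _ A) as [L|L].
    + destruct (IH x' D) as (o & S1 & S2 & S3). exists o.
      assert (d x o <= d x x' + d x' o) by apply tdist_tri.
      assert (d x y <= d x o + d o y) by apply tdist_tri.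
      assert (d x z <= d x o + d o z) by apply tdist_tri.
      rewrite (tdist_adj _ _ A) in H. rewrite (tdist_sym z x), (tdist_sym z x') in L. lia.
    + exists x. assert (H := increasing_ray z n x x' y A E D L).
      rewrite tdist_refl, (tdist_sym y x), (tdist_sym y z), (tdist_sym x z) in *. lia.
Qed.

Lemma seg_collinear x y m n : inseg T x y m -> inseg T x y n -> d x m <= d x n ->
  d x m + d m n = d x n.
Proof.
  intros Hm Hn L. destruct (point_at x n (d x m) L) as (m' & S' & D').
  assert (m' = m).
  { apply (seg_unique x y); auto. unfold inseg in *.
    assert (d m' y <= d m' n + d n y) by apply tdist_tri.
    assert (d x y <= d x m' + d m' y) by apply tdist_tri. lia. }
  subst. exact S'.
Qed.

Lemma four_point_ordered x y z w m n :
  inseg T x y m -> inseg T z y m -> inseg T x y n -> inseg T x w n -> d x m <= d x n ->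
  d x y + d z w <= d x w + d y z.
Proof.
  intros Hm Hm' Hn Hn' L. assert (C := seg_collinear x y m n Hm Hn L).
  unfold inseg in *.
  assert (d z w <= d z m + d m w) by apply tdist_tri.
  assert (d m w <= d m n + d n w) by apply tdist_tri.
  rewrite (tdist_sym y z). lia.
Qed.

Lemma inseg_sym x y z : inseg T x y z -> inseg T y x z.
Proof. unfold inseg. rewrite (tdist_sym x z), (tdist_sym z y), (tdist_sym x y). lia. Qed.

(** This is 0-hyperbolicity: the order of the branch points towards [z] and [w] on the segment from
    [x] to [y] decides which alternative holds. *)
Lemma four_point x y z w :
  d x y + d z w <= d x z + d y w \/ d x y + d z w <= d x w + d y z.
Proof.
  destruct (median x y z) as (m & M1 & M2 & M3).
  destruct (median x y w) as (n & N1 & N2 & N3).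
  destruct (Nat.le_ge_cases (d x m) (d x n)) as [L|L].
  - right. apply (four_point_ordered x y z w m n); auto using inseg_sym.
  - left. rewrite (tdist_sym z w).
    apply (four_point_ordered x y w z n m); auto using inseg_sym.
Qed.

End TreeMetric.

(** * Decoding group elements along geodesics *)

Declare Scope group_scope.
Delimit Scope group_scope with G.
Notation "x * y" := (gmul _ x y) : group_scope.
Notation "x ^-1" := (ginv _ x) (at level 3, left associativity, format "x ^-1") : group_scope.
Notation "1" := (gone _) : group_scope.
Bind Scope group_scope with gcar.
Local Open Scope group_scope.

(** * Group identities and ordered products *)

Section GroupTheory.
Variable G : Group.
Implicit Types x y z : G.

Lemma gmulKV x y : x^-1 * (x * y) = y.
Proof. now rewrite gmulA, gmulV, gmul1. Qed.

Lemma gmul_injl x y z : x * y = x * z -> y = z.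
Proof. intro H. rewrite <- (gmulKV x y), H. apply gmulKV. Qed.

Lemma gmulr1 x : x * 1 = x.
Proof. apply (gmul_injl (x^-1)). now rewrite gmulA, gmulV, gmul1. Qed.

Lemma gmulrV x : x * x^-1 = 1.
Proof. apply (gmul_injl (x^-1)). now rewrite gmulA, gmulV, gmul1, gmulr1. Qed.

Lemma gmulVK x y : x * (x^-1 * y) = y.
Proof. now rewrite gmulA, gmulrV, gmul1. Qed.

Lemma ginv_unique x y : x * y = 1 -> y = x^-1.
Proof. intro H. apply (gmul_injl x). now rewrite H, gmulrV. Qed.

Lemma ginvK x : (x^-1)^-1 = x.
Proof. symmetry. apply ginv_unique, gmulV. Qed.

Lemma ginvM x y : (x * y)^-1 = y^-1 * x^-1.
Proof. symmetry. apply ginv_unique. now rewrite <- gmulA, gmulVK, gmulrV. Qed.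

Lemma ginv1 : (gone G)^-1 = 1.
Proof. symmetry. apply ginv_unique, gmul1. Qed.

Fixpoint gseq (n : nat) (F : nat -> G) : G :=
  match n with 0 => 1 | S n => gseq n F * F n end.

Lemma gseq_ext n F F' : (forall k, k < n -> F k = F' k) -> gseq n F = gseq n F'.
Proof. induction n as [|n IH]; simpl; intro H; auto. rewrite IH, (H n); auto. Qed.

Lemma gseq_add m n F : gseq (m + n) F = gseq m F * gseq n (fun k => F (m + k)).
Proof.
  induction n as [|n IH]; simpl.
  - now rewrite Nat.add_0_r, gmulr1.
  - rewrite Nat.add_succ_r. simpl. now rewrite IH, gmulA.
Qed.

Lemma gseq_shift n F : gseq (S n) F = F 0 * gseq n (fun k => F (S k)).
Proof. change (S n) with (1 + n). rewrite gseq_add. simpl. now rewrite gmul1. Qed.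

Lemma gseq_inv n F : (gseq n F)^-1 = gseq n (fun k => (F (n - 1 - k))^-1).
Proof.
  induction n as [|n IH].
  - apply ginv1.
  - transitivity ((F n)^-1 * (gseq n F)^-1); [apply ginvM|].
    rewrite gseq_shift, IH.
    replace (S n - 1 - 0) with n by lia. f_equal. apply gseq_ext.
    intros k Hk. f_equal. f_equal. lia.
Qed.

End GroupTheory.
Arguments gseq {G}.

Ltac gsimp := repeat (rewrite <- ?gmulA, ?gmul1, ?gmulr1, ?gmulV, ?gmulrV, ?gmulKV, ?gmulVK,
   ?ginvK, ?ginvM, ?ginv1; try reflexivity).

(** * Group elements as isometries of the tree *)

Section ActionMetric.
Variables (G : Group) (T : Tree) (A : Action G T).
Hypothesis HT : is_tree T.
Local Notation d := (Defs.dist T).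

Lemma act_invK g v : act A (g^-1) (act A g v) = v.
Proof. now rewrite <- act_mul, gmulV, act_one. Qed.

Lemma act_Kinv g v : act A g (act A (g^-1) v) = v.
Proof. now rewrite <- act_mul, gmulrV, act_one. Qed.

Lemma walk_act g x y n : Walk T x y n -> Walk T (act A g x) (act A g y) n.
Proof.
  induction 1; econstructor; eauto. now apply act_adj.
Qed.

Lemma tdist_act g x y : d (act A g x) (act A g y) = d x y.
Proof.
  apply Nat.le_antisymm.
  - apply tdist_spec, walk_act, tdist_spec; auto.
  - rewrite <- (act_invK g x) at 1. rewrite <- (act_invK g y) at 1.
    apply tdist_spec, walk_act, tdist_spec; auto.
Qed.

Lemma inseg_act g x y z : inseg T (act A g x) (act A g y) (act A g z) <-> inseg T x y z.
Proof. unfold inseg. now rewrite !tdist_act. Qed.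

End ActionMetric.

Section Decoder.
Variables (G : Group) (T : Tree) (A : Action G T) (H : Group).
Hypothesis HT : is_tree T.
Local Notation d := (Defs.dist T).
Local Notation V := (vert T).
Local Notation seg := (inseg T).

Definition pattern := V -> V -> Prop.

Fixpoint read (l : list (pattern * H)) (v y : V) : H :=
  match l with
  | [] => 1
  | (P, h) :: l' =>
      (if excluded_middle_informative (exists q, seg v y q /\ P v q) then h else 1)
      * read l' v y
  end.

Definition vertex_at (x y : V) (k : nat) : V :=
  epsilon (inhabits x) (fun z => seg x y z /\ d x z = k).

(* At each vertex v of [x, y] the occurrences starting at v and running towards y
   are read positively, those starting at v and running towards x negatively; this
   makes the reading of [y, x] inverse to that of [x, y]. *)
Definition decode (l : list (pattern * H)) (x y : V) : H :=
  gseq (S (d x y))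
    (fun k => (read l (vertex_at x y k) x)^-1 * read l (vertex_at x y k) y).

Definition crosses (P : pattern) (x y o : V) : Prop :=
  exists v q, seg x y v /\ seg x y q /\ P v q /\ d x v < d x o < d x q.

Definition unbroken (l : list (pattern * H)) (x y o : V) : Prop :=
  Forall (fun Ph => ~ crosses (fst Ph) x y o /\ ~ crosses (fst Ph) y x o) l.

Definition irrefl_patterns (l : list (pattern * H)) : Prop :=
  Forall (fun Ph => forall v, ~ fst Ph v v) l.

Definition invariant_patterns (l : list (pattern * H)) : Prop :=
  Forall (fun Ph => forall g v q, fst Ph (act A g v) (act A g q) <-> fst Ph v q) l.

Lemma vertex_at_spec x y k : k <= d x y -> seg x y (vertex_at x y k) /\ d x (vertex_at x y k) = k.
Proof. intro Hk. unfold vertex_at. apply epsilon_spec. now apply point_at. Qed.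

Lemma vertex_at_eq x y z : seg x y z -> vertex_at x y (d x z) = z.
Proof.
  intro S. assert (L : d x z <= d x y) by (unfold inseg in S; lia).
  destruct (vertex_at_spec x y _ L) as [S' D']. now apply (seg_unique T HT x y).
Qed.

Lemma seg_trans_l x y o v : seg x y o -> seg x o v -> seg x y v /\ seg v y o.
Proof.
  unfold inseg. intros S S'.
  assert (I1 := tdist_tri T HT x v y). assert (I2 := tdist_tri T HT v o y). lia.
Qed.

Lemma seg_trans_r x y o v : seg x y o -> seg o y v -> seg x y v /\ seg x v o.
Proof.
  unfold inseg. intros S S'.
  assert (I1 := tdist_tri T HT x v y). assert (I2 := tdist_tri T HT x o v). lia.
Qed.

Lemma seg_left x y : seg x y x.
Proof. unfold inseg. now rewrite tdist_refl. Qed.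

Lemma seg_right x y : seg x y y.
Proof. unfold inseg. rewrite (tdist_refl T HT y). lia. Qed.

Lemma read_ext l v y y' :
  Forall (fun Ph => (exists q, seg v y q /\ fst Ph v q) <-> (exists q, seg v y' q /\ fst Ph v q)) l ->
  read l v y = read l v y'.
Proof.
  induction 1 as [|[P h] l E _ IH]; simpl in *; auto. rewrite IH. f_equal.
  destruct excluded_middle_informative, excluded_middle_informative; tauto.
Qed.

Lemma read_self l v : irrefl_patterns l -> read l v v = 1.
Proof.
  induction 1 as [|[P h] l E _ IH]; simpl in *; auto. rewrite IH.
  destruct excluded_middle_informative as [(q & S & Hq)|]; [exfalso|apply gmul1].
  apply (E v). unfold inseg in S. rewrite (tdist_refl T HT v) in S.
  rewrite <- (tdist0_eq T HT v q) in Hq by lia. exact Hq.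
Qed.

(** An occurrence that starts before [o] and runs towards [y] either ends by [o] or crosses it. At
    [v = o] this fails, since an occurrence starting at [o] does not cross [o]. *)
Lemma read_cut l x y o v : seg x y o -> seg x o v -> v <> o ->
  Forall (fun Ph => ~ crosses (fst Ph) x y o) l -> read l v y = read l v o.
Proof.
  intros So Sv Hne N. apply read_ext. eapply Forall_impl; [|exact N].
  intros [P h] NC; simpl in *.
  destruct (seg_trans_l _ _ _ _ So Sv) as [Sv' So'].
  assert (0 < d v o) by (destruct (d v o) eqn:E; [now apply tdist0_eq in E|lia]).
  split; intros (q & Sq & Pq); exists q; split; auto.
  - destruct (seg_trans_r _ _ _ _ Sv' Sq) as [Sq' Svq].
    destruct (Nat.le_gt_cases (d x q) (d x o)) as [L|L].
    + assert (C := seg_collinear T HT v y q o Sq So').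
      unfold inseg in *. lia.
    + exfalso. apply NC. exists v, q. unfold inseg in *. repeat split; auto; lia.
  - apply (seg_trans_l _ _ _ _ So' Sq).
Qed.

(** Cutting at [o] loses nothing: the factor at [o] consists of a negative reading towards [x],
    which ends the first half, and a positive one towards [y], which starts the second; [read_self]
    makes the other readings at [o] trivial. *)
Lemma decode_split l x y o : irrefl_patterns l -> seg x y o -> unbroken l x y o ->
  decode l x y = decode l x o * decode l o y.
Proof.
  intros I So U.
  assert (U1 : Forall (fun Ph => ~ crosses (fst Ph) x y o) l).
  { eapply Forall_impl; [|exact U]. simpl. tauto. }
  assert (U2 : Forall (fun Ph => ~ crosses (fst Ph) y x o) l).
  { eapply Forall_impl; [|exact U]. simpl. tauto. }
  unfold decode.
  replace (S (d x y)) with (d x o + S (d o y)) by (unfold inseg in So; lia).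
  rewrite gseq_add, !(gseq_shift _ (d o y)), Nat.add_0_r, (vertex_at_eq _ _ _ So).
  replace (vertex_at o y 0) with o.
  2:{ rewrite <- (tdist_refl T HT o) at 1. symmetry. apply vertex_at_eq, seg_left. }
  cbn [gseq]. rewrite (vertex_at_eq _ _ _ (seg_right x o)).
  rewrite (read_self l o I).
  rewrite (gseq_ext _ (d x o) _
    (fun k => (read l (vertex_at x o k) x)^-1 * read l (vertex_at x o k) o)).
  - rewrite (gseq_ext _ (d o y) _
      (fun k => (read l (vertex_at o y (S k)) o)^-1 * read l (vertex_at o y (S k)) y)).
    + gsimp.
    + intros k Hk. destruct (vertex_at_spec o y (S k)) as [S1 D1]; [lia|].
      set (v := vertex_at o y (S k)) in *.
      destruct (seg_trans_r _ _ _ _ So S1) as [S2 S3].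
      replace (vertex_at x y (d x o + S k)) with v.
      2:{ rewrite <- D1, S3. symmetry. now apply vertex_at_eq. }
      f_equal. f_equal. apply read_cut with y; auto using inseg_sym.
      intros E. rewrite E in D1. rewrite tdist_refl in D1; auto. lia.
  - intros k Hk. destruct (vertex_at_spec x o k) as [S1 D1]; [lia|].
    set (v := vertex_at x o k) in *.
    destruct (seg_trans_l _ _ _ _ So S1) as [S2 S3].
    replace (vertex_at x y k) with v.
    2:{ rewrite <- D1. symmetry. now apply vertex_at_eq. }
    f_equal. apply read_cut with x; auto. intros E. rewrite E in D1. lia.
Qed.

Lemma decode_inv l x y : decode l y x = (decode l x y)^-1.
Proof.
  unfold decode. rewrite gseq_inv, (tdist_sym T HT y x). apply gseq_ext. intros k Hk.
  destruct (vertex_at_spec x y (d x y - k)) as [S1 D1]; [lia|].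
  replace (S (d x y) - 1 - k) with (d x y - k) by lia.
  set (v := vertex_at x y (d x y - k)) in *.
  replace (vertex_at y x k) with v; [now gsimp|].
  replace k with (d y v).
  - symmetry. apply vertex_at_eq. now apply inseg_sym.
  - unfold inseg in S1. rewrite tdist_sym; auto. lia.
Qed.

Lemma read_act l g v y : invariant_patterns l -> read l (act A g v) (act A g y) = read l v y.
Proof.
  induction 1 as [|[P h] l E _ IH]; simpl in *; auto. rewrite IH. f_equal.
  assert ((exists q, seg (act A g v) (act A g y) q /\ P (act A g v) q) <->
          (exists q, seg v y q /\ P v q)).
  { split; intros (q & Sq & Pq).
    - exists (act A (g^-1) q). rewrite <- (act_Kinv G T A g q) in Sq, Pq.
      now rewrite inseg_act in Sq by auto; rewrite E in Pq.
    - exists (act A g q). now rewrite inseg_act by auto; rewrite E. }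
  destruct excluded_middle_informative, excluded_middle_informative; tauto.
Qed.

Lemma decode_act l g x y : invariant_patterns l -> decode l (act A g x) (act A g y) = decode l x y.
Proof.
  intro I. unfold decode. rewrite tdist_act by auto. apply gseq_ext. intros k Hk.
  destruct (vertex_at_spec x y k) as [S1 D1]; [lia|].
  set (v := vertex_at x y k) in *.
  replace (vertex_at (act A g x) (act A g y) k) with (act A g v); [now rewrite !read_act|].
  rewrite <- D1, <- (tdist_act G T A HT g). symmetry. apply vertex_at_eq. now rewrite inseg_act.
Qed.

(** Split all three sides at the centre; the two readings of the leg between [y] and [o] are inverse
    and cancel. *)
Lemma decode_triangle l x y z o : irrefl_patterns l ->
  seg x y o -> seg y z o -> seg x z o ->
  unbroken l x y o -> unbroken l y z o -> unbroken l x z o ->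
  decode l x y * decode l y z = decode l x z.
Proof.
  intros I S1 S2 S3 U1 U2 U3.
  rewrite (decode_split l x y o), (decode_split l y z o), (decode_split l x z o) by auto.
  rewrite (decode_inv l y o). gsimp.
Qed.

Lemma decode_skip P h l x y :
  (forall v q, seg x y v -> seg x y q -> ~ P v q) ->
  decode ((P, h) :: l) x y = decode l x y.
Proof.
  intro N. unfold decode. apply gseq_ext. intros k Hk.
  destruct (vertex_at_spec x y k) as [S1 _]; [lia|]. simpl.
  destruct excluded_middle_informative as [(q & Sq & Pq)|_].
  { exfalso. apply (N _ q S1); auto.
    exact (proj1 (seg_trans_l _ _ _ _ S1 (inseg_sym T HT _ _ _ Sq))). }
  destruct excluded_middle_informative as [(q & Sq & Pq)|_].
  { exfalso. apply (N _ q S1); auto. exact (proj1 (seg_trans_r _ _ _ _ S1 Sq)). }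
  now gsimp.
Qed.

(** The outer factors are chosen before [h], so the equation prescribing the decoded value can later
    be solved for [h]. *)
Lemma decode_once P l x y p : seg x y p ->
  (exists q, seg p y q /\ P p q) ->
  (forall v q, seg x y v -> seg v y q -> P v q -> v = p) ->
  (forall v q, seg x y v -> seg v x q -> ~ P v q) ->
  exists u w, forall h, decode ((P, h) :: l) x y = u * h * w.
Proof.
  intros Sp Ep Up Np.
  set (F := fun k => (read l (vertex_at x y k) x)^-1 * read l (vertex_at x y k) y).
  exists (gseq (d x p) F * (read l p x)^-1),
    (read l p y * gseq (d p y) (fun k => F (d x p + S k))).
  intro h. unfold decode.
  replace (S (d x y)) with (d x p + S (d p y)) by (unfold inseg in Sp; lia).
  rewrite gseq_add, gseq_shift, Nat.add_0_r, (vertex_at_eq _ _ _ Sp).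
  assert (E : forall k, k <= d x y -> k <> d x p ->
    (read ((P, h) :: l) (vertex_at x y k) x)^-1 * read ((P, h) :: l) (vertex_at x y k) y = F k).
  { intros k Hk Hne. destruct (vertex_at_spec x y k Hk) as [S1 D1]. simpl.
    destruct excluded_middle_informative as [(q & Sq & Pq)|_].
    { exfalso. eapply Np; eauto. }
    destruct excluded_middle_informative as [(q & Sq & Pq)|_].
    { exfalso. apply Hne. rewrite <- D1. f_equal. eapply Up; eauto. }
    unfold F. now gsimp. }
  rewrite (gseq_ext _ (d x p) _ F).
  2:{ intros k Hk. apply E; unfold inseg in Sp; lia. }
  rewrite (gseq_ext _ (d p y) _ (fun k => F (d x p + S k))).
  2:{ intros k Hk. apply E; unfold inseg in Sp; lia. }
  simpl. destruct excluded_middle_informative as [(q & Sq & Pq)|_].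
  { exfalso. eapply Np; eauto. }
  destruct excluded_middle_informative as [_|NE]; [|tauto].
  gsimp.
Qed.

End Decoder.


(* 18 = 3 sides of a tripod, read in 2 directions, each spoiling at most 3 patterns. *)
Fixpoint term_cost (t : term) : nat :=
  match t with
  | tvar _ | tone => 0
  | tmul t1 t2 => term_cost t1 + term_cost t2 + 18
  | tinv t => term_cost t
  end.

Fixpoint form_cost (f : pform) : nat :=
  match f with
  | peq t1 t2 => term_cost t1 + term_cost t2
  | pand f1 f2 | por f1 f2 => form_cost f1 + form_cost f2
  | pall _ f | pex _ f => form_cost f
  end.

(** * Families of patterns *)

Section Families.
Variables (G : Group) (T : Tree) (A : Action G T).
Local Notation d := (Defs.dist T).

Definition family := nat -> pattern T.

Definition good_family (M : nat) (F : family) : Prop :=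
  (forall j v, ~ F j v v) /\
  (forall j g v q, F j (act A g v) (act A g q) <-> F j v q) /\
  (forall x y o, inseg T x y o -> exists b, length b <= 3 /\
     forall j, j < M -> crosses T (F j) x y o -> In j b).

Definition occurs_once (P : pattern T) (x y : vert T) : Prop :=
  exists p, inseg T x y p /\
    (exists q, inseg T p y q /\ P p q) /\
    (forall v q, inseg T x y v -> inseg T v y q -> P v q -> v = p) /\
    (forall v q, inseg T x y v -> inseg T v x q -> ~ P v q).

(** [D] stands for the displacement of everything played so far: patterns longer than [D] are
    invisible on those earlier elements. *)
Definition encodable (s : vert T) (M : nat) : Prop :=
  forall D, exists F g, good_family M F /\
    (forall j v q, F j v q -> D < d v q) /\
    (forall j, j < M -> occurs_once (F j) s (act A g s)).

End Families.
Arguments good_family {G T}.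
Arguments encodable {G T}.

(** * Transfer of positive sentences by decoding *)

Section Transfer.
Variables (G : Group) (T : Tree) (A : Action G T) (H : Group) (s : vert T) (M : nat).
Hypothesis HT : is_tree T.
Local Notation d := (Defs.dist T).

(* The families of a context are numbered from the outermost quantifier inwards, so that
   Bad stays meaningful when the context is extended at its head. *)
Inductive selects (Bad : nat -> list nat) : list (family T) -> list (pattern T * H) -> Prop :=
| sel_nil : selects Bad [] []
| sel_cons F C l j h : selects Bad C l -> j < M -> ~ In j (Bad (length C)) ->
    selects Bad (F :: C) ((F j, h) :: l).

Lemma selects_mono Bad Bad' C l :
  (forall k, k < length C -> incl (Bad' k) (Bad k)) -> selects Bad C l -> selects Bad' C l.
Proof.
  intros I S. induction S as [|F C l j h S IH Hj HB]; constructor; simpl in *; auto.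
  intro HB'. apply HB. apply (I (length C)); auto.
Qed.

Lemma selects_good Bad C l : Forall (good_family A M) C -> selects Bad C l ->
  irrefl_patterns T H l /\ invariant_patterns G T A H l.
Proof.
  intros HC S. induction S as [|F C l j h S IH Hj HB]; [split; constructor|].
  inversion HC as [|? ? HF HC']; subst. destruct (IH HC') as [I1 I2].
  destruct HF as (F1 & F2 & _). split; constructor; simpl; auto.
Qed.

(** The spoiled indices depend only on the families, not on the selected patterns or their values.
    Each family loses at most three indices per direction, hence six. *)
Lemma bad_point C x y o : Forall (good_family A M) C -> inseg T x y o ->
  exists Bad, (forall k, length (Bad k) <= 6) /\
    forall l, selects Bad C l -> unbroken T H l x y o.
Proof.
  intros HC So. induction HC as [|F C HF HC IH].
  - exists (fun _ => []). split; [simpl; lia|]. intros l S. inversion S. constructor.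
  - destruct IH as (Bad & L & HB). destruct HF as (_ & _ & HF).
    destruct (HF x y o So) as (b1 & L1 & B1).
    destruct (HF y x o (inseg_sym T HT _ _ _ So)) as (b2 & L2 & B2).
    exists (fun k => if k =? length C then b1 ++ b2 else Bad k). split.
    + intro k. destruct (k =? length C); auto. rewrite length_app. lia.
    + intros l S. inversion S as [|F' C' l' j h S' Hj Hn]; subst.
      rewrite Nat.eqb_refl in Hn. constructor.
      * simpl. split; intro X; apply Hn, in_or_app; auto.
      * apply HB. eapply selects_mono; [|exact S']. intros k Hk. cbv beta.
        destruct (Nat.eqb_spec k (length C)); [lia|]. apply incl_refl.
Qed.

Definition decode_elt (l : list (pattern T * H)) (g : G) : H := decode T H l s (act A g s).

Lemma decode_elt1 l : decode_elt l 1 = 1.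
Proof.
  unfold decode_elt, decode. rewrite act_one, tdist_refl by auto. simpl.
  assert (E : vertex_at T s s 0 = s).
  { rewrite <- (tdist_refl T HT s) at 1. apply vertex_at_eq; auto. now apply seg_left. }
  rewrite E. now gsimp.
Qed.

Lemma decode_eltV Bad C l g : Forall (good_family A M) C -> selects Bad C l ->
  decode_elt l (g^-1) = (decode_elt l g)^-1.
Proof.
  intros HC S. destruct (selects_good _ _ _ HC S) as [_ I].
  unfold decode_elt. rewrite <- decode_inv by auto.
  rewrite <- (decode_act G T A H HT l g) by auto. now rewrite act_Kinv.
Qed.

(** By invariance the side from [g s] to [g h s] reads like the segment from [s] to [h s], so
    [decode_triangle] at the centre of the tripod applies whenever no selected pattern is spoiled
    there. *)
Lemma decode_eltM C g h : Forall (good_family A M) C ->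
  exists Bad, (forall k, length (Bad k) <= 18) /\
    forall l, selects Bad C l -> decode_elt l (g * h) = decode_elt l g * decode_elt l h.
Proof.
  intro HC.
  destruct (median T HT s (act A g s) (act A (g * h) s)) as (o & S1 & S3 & S2).
  destruct (bad_point C _ _ _ HC S1) as (B1 & L1 & U1).
  destruct (bad_point C _ _ _ HC S2) as (B2 & L2 & U2).
  destruct (bad_point C _ _ _ HC S3) as (B3 & L3 & U3).
  exists (fun k => B1 k ++ B2 k ++ B3 k). split.
  - intro k. rewrite !length_app. specialize (L1 k). specialize (L2 k). specialize (L3 k). lia.
  - intros l S. destruct (selects_good _ _ _ HC S) as [I1 I2].
    unfold decode_elt. rewrite <- (decode_act G T A H HT l g s (act A h s)) by auto.
    rewrite <- act_mul. symmetry. apply decode_triangle with o; auto.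
    + apply U1. eapply selects_mono; [|exact S]. intros k _ j Hj. apply in_or_app; auto.
    + apply U2. eapply selects_mono; [|exact S]. intros k _ j Hj.
      apply in_or_app; right; apply in_or_app; auto.
    + apply U3. eapply selects_mono; [|exact S]. intros k _ j Hj.
      apply in_or_app; right; apply in_or_app; auto.
Qed.

Local Notation tvalG := (tval G (gmul G) (ginv G) (gone G)).
Local Notation tvalH := (tval H (gmul H) (ginv H) (gone H)).
Local Notation satG := (sat G (gmul G) (ginv G) (gone G) eq).
Local Notation satH := (sat H (gmul H) (ginv H) (gone H) eq).

Lemma decode_term C e t : Forall (good_family A M) C ->
  exists Bad, (forall k, length (Bad k) <= term_cost t) /\
    forall l, selects Bad C l ->
      decode_elt l (tvalG e t) = tvalH (fun n => decode_elt l (e n)) t.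
Proof.
  intro HC. induction t as [n| |t1 IH1 t2 IH2|t IH]; simpl.
  - exists (fun _ => []). simpl. auto.
  - exists (fun _ => []). simpl. split; auto. intros. apply decode_elt1.
  - destruct IH1 as (B1 & L1 & E1), IH2 as (B2 & L2 & E2).
    destruct (decode_eltM C (tvalG e t1) (tvalG e t2) HC) as (B3 & L3 & E3).
    exists (fun k => B1 k ++ B2 k ++ B3 k). split.
    + intro k. rewrite !length_app. specialize (L1 k). specialize (L2 k). specialize (L3 k). lia.
    + intros l S. rewrite E3, E1, E2; auto;
      (eapply selects_mono; [|exact S]; intros k _ j Hj; rewrite !in_app_iff; auto).
  - destruct IH as (B & L & E). exists B. split; auto. intros l S.
    rewrite (decode_eltV _ _ _ _ HC S). f_equal. auto.
Qed.

Lemma fresh_index b m : length b < m -> exists j, j < m /\ ~ In j b.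
Proof.
  intro L. apply NNPP. intro N.
  assert (I : incl (seq 0 m) b).
  { intros j Hj. apply in_seq in Hj. apply NNPP. intro X. apply N. exists j. split; [lia|auto]. }
  apply NoDup_incl_length in I; [|apply seq_NoDup]. rewrite length_seq in I. lia.
Qed.

Lemma upd_comp (K L : Type) (c : K -> L) (e : nat -> K) n x :
  (fun k => c (upd K e n x k)) = upd L (fun k => c (e k)) n (c x).
Proof.
  apply functional_extensionality. intro k. unfold upd. now destruct (k =? n).
Qed.

(** The spoiled indices are collected for the whole formula before any pattern is selected. This
    lets the induction run inside [G] first, and the opponent's values in [H] enter only through the
    later choice of [l]. *)
Lemma decode_sat f : encodable A s M -> form_cost f < M -> forall C e D,
  Forall (good_family A M) C -> (forall n, d s (act A (e n) s) <= D) -> satG e f ->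
  exists Bad, (forall k, length (Bad k) <= form_cost f) /\
    forall l, selects Bad C l -> satH (fun n => decode_elt l (e n)) f.
Proof.
  intros EN. induction f as [t1 t2|f1 IH1 f2 IH2|f1 IH1 f2 IH2|n f IH|n f IH];
    simpl; intros HM C e D HC HD HS.
  - destruct (decode_term C e t1 HC) as (B1 & L1 & E1).
    destruct (decode_term C e t2 HC) as (B2 & L2 & E2).
    exists (fun k => B1 k ++ B2 k). split.
    + intro k. rewrite length_app. specialize (L1 k). specialize (L2 k). lia.
    + intros l S. rewrite <- E1, <- E2, HS; auto;
      (eapply selects_mono; [|exact S]; intros k _ j Hj; rewrite !in_app_iff; auto).
  - destruct HS as [HS1 HS2].
    destruct (IH1 ltac:(lia) C e D HC HD HS1) as (B1 & L1 & E1).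
    destruct (IH2 ltac:(lia) C e D HC HD HS2) as (B2 & L2 & E2).
    exists (fun k => B1 k ++ B2 k). split.
    + intro k. rewrite length_app. specialize (L1 k). specialize (L2 k). lia.
    + intros l S. split; [apply E1|apply E2];
      (eapply selects_mono; [|exact S]; intros k _ j Hj; rewrite !in_app_iff; auto).
  - destruct HS as [HS|HS].
    + destruct (IH1 ltac:(lia) C e D HC HD HS) as (B & L & E). exists B.
      split; [|auto]. intro k. specialize (L k). lia.
    + destruct (IH2 ltac:(lia) C e D HC HD HS) as (B & L & E). exists B.
      split; [|auto]. intro k. specialize (L k). lia.
  (* The opponent in [G] plays an element carrying a fresh family of patterns too long to occur on
     earlier segments. *)
  - destruct (EN D) as (F & g & HF & Long & Once).
    destruct (IH HM (F :: C) (upd G e n g) (D + d s (act A g s))) as (B & L & E).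
    + now constructor.
    + intro k. unfold upd. destruct (k =? n); [lia|]. specialize (HD k). lia.
    + apply HS.
    + exists B. split; auto. intros l S h.
      destruct (fresh_index (B (length C)) M) as (j & Hj & Bj).
      { specialize (L (length C)). lia. }
      destruct (Once j Hj) as (p & O1 & O2 & O3 & O4).
      destruct (decode_once T H HT (F j) l s (act A g s) p O1 O2 O3 O4) as (u & w & E').
      (* The unspoiled pattern receives the value that makes [g] decode to the prescribed [h]. *)
      specialize (E ((F j, u^-1 * h * w^-1) :: l) (sel_cons _ F C l j _ S Hj Bj)).
      rewrite upd_comp in E. unfold decode_elt in E at 2. rewrite E' in E.
      replace (u * (u^-1 * h * w^-1) * w) with h in E by now gsimp.
      refine (eq_ind _ (fun e' => satH e' f) E _ _).
      apply functional_extensionality. intro k. unfold upd. destruct (k =? n); auto.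
      (* The other variables keep their decoded values, since a segment of length at most [D]
         contains no occurrence of the new pattern. *)
      unfold decode_elt. apply decode_skip; auto.
      intros v q Sv Sq Pq. apply Long in Pq. specialize (HD k).
      unfold inseg in Sv, Sq. destruct (Nat.le_gt_cases (d s v) (d s q)) as [Lv|Lv].
      * assert (X := seg_collinear T HT _ _ v q Sv Sq Lv). lia.
      * assert (X := seg_collinear T HT _ _ q v Sq Sv (Nat.lt_le_incl _ _ Lv)).
        rewrite (tdist_sym T HT q v) in X. lia.
  - destruct HS as [g HS].
    destruct (IH HM C (upd G e n g) (D + d s (act A g s)) HC) as (B & L & E).
    + intro k. unfold upd. destruct (k =? n); [lia|]. specialize (HD k). lia.
    + apply HS.
    (* The witness in [H] is the decoded witness of [G]; no family is added, but the displacement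
       bound has grown. *)
    + exists B. split; auto. intros l S. exists (decode_elt l g).
      rewrite <- upd_comp. auto.
Qed.

End Transfer.

Lemma encodable_transfer (G : Group) (T : Tree) (A : Action G T) s :
  is_tree T -> (forall M, encodable A s M) ->
  forall f, GHolds G f -> forall H : Group, GHolds H f.
Proof.
  intros HT EN f HG H.
  (* One pattern more than the cost leaves an unspoiled index in every family. *)
  destruct (decode_sat G T A H s (S (form_cost f)) HT f (EN _) (Nat.lt_succ_diag_r _)
    [] (fun _ => gone G) 0 (Forall_nil _)) as (B & _ & E).
  - intro n. rewrite act_one, tdist_refl; auto.
  - exact HG.
  - specialize (E [] (sel_nil _ _ _ _)).
    refine (eq_ind _ (fun e' => sat H (gmul H) (ginv H) (gone H) eq e' f) E _ _).
    apply functional_extensionality. intro n. now apply decode_elt1.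
Qed.

Close Scope group_scope.

(** * Patterns from two elements with short overlaps *)

Section Lines.
Variable T : Tree.
Hypothesis HT : is_tree T.
Local Notation d := (Defs.dist T).
Local Notation seg := (inseg T).

Lemma seg_convex x y u v z : seg x y u -> seg x y v -> seg u v z -> seg x y z.
Proof.
  intros Su Sv Sz.
  destruct (Nat.le_ge_cases (d x u) (d x v)) as [L|L].
  - assert (C := seg_collinear T HT x y u v Su Sv L).
    assert (seg x v u) as Su' by exact C.
    destruct (seg_trans_r T HT _ _ _ _ Su' Sz) as [Sz' _].
    apply (seg_trans_l T HT _ _ _ _ Sv Sz').
  - assert (C := seg_collinear T HT x y v u Sv Su L).
    assert (seg x u v) as Sv' by exact C.
    destruct (seg_trans_r T HT _ _ _ _ Sv' (inseg_sym T HT _ _ _ Sz)) as [Sz' _].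
    apply (seg_trans_l T HT _ _ _ _ Su Sz').
Qed.

Lemma line_dist x y u v : seg x y u -> seg x y v ->
  d x u + d u v = d x v \/ d x v + d u v = d x u.
Proof.
  intros Su Sv. destruct (Nat.le_ge_cases (d x u) (d x v)) as [L|L].
  - left. now apply seg_collinear with y.
  - right. rewrite (tdist_sym T HT u v). now apply seg_collinear with y.
Qed.

Lemma seg_between x y u v z : seg x y u -> seg x y v -> seg x y z ->
  d x u <= d x z <= d x v -> seg u v z.
Proof.
  intros Su Sv Sz [L1 L2]. unfold inseg.
  assert (C1 := seg_collinear T HT x y u z Su Sz L1).
  assert (C2 := seg_collinear T HT x y z v Sz Sv L2).
  assert (C3 := seg_collinear T HT x y u v Su Sv (Nat.le_trans _ _ _ L1 L2)). lia.
Qed.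

(** The side from [x] to [y] is cut by the median of the tripod with [t], and an edge cannot
    straddle this vertex. *)
Lemma edge_split x y t z z' : seg x y z -> seg x y z' -> d z z' = 1 ->
  (seg x t z /\ seg x t z') \/ (seg t y z /\ seg t y z').
Proof.
  intros S S' E. destruct (median T HT x y t) as (m & M1 & M2 & M3).
  assert (C := line_dist x y z z' S S').
  destruct (Nat.le_gt_cases (d x z) (d x m)) as [L|L];
  destruct (Nat.le_gt_cases (d x z') (d x m)) as [L'|L'].
  1: left. 2, 3, 4: right.
  2, 3, 4: assert (seg m y z /\ seg m y z') as [X X'] by
    (split; apply (seg_between x y); auto using seg_right; unfold inseg in *;
      rewrite ?(tdist_refl T HT) in *; lia);
    split; apply inseg_sym; auto;
    refine (proj1 (seg_trans_l T HT _ _ m _ M3 _)); now apply inseg_sym.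
  split; (refine (proj1 (seg_trans_l T HT _ _ m _ M2 _));
    apply (seg_between x y); auto using seg_left; rewrite ?tdist_refl by auto; lia).
Qed.

(** The first hypothesis bounds by [k] the Gromov product of [x0] and [x2] at [x1], that is, the leg
    of the tripod ending at [x1]; beyond this leg the two geodesics to [x2] agree. *)
Lemma seg_trim k x0 x1 x2 r : d x0 x1 + d x1 x2 <= d x0 x2 + 2 * k ->
  seg x1 x2 r -> k <= d x1 r -> seg x0 x2 r.
Proof.
  unfold inseg. intros F S L.
  assert (I := tdist_tri T HT x0 r x2).
  destruct (four_point T HT x0 r x1 x2) as [Q|Q]; rewrite ?(tdist_sym T HT r x1) in Q; lia.
Qed.

End Lines.

(** * Geodesics of positive words in two elements with short overlaps *)

Section Generators.
Variables (G : Group) (T : Tree) (A : Action G T).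
Hypothesis HT : is_tree T.
Local Notation d := (Defs.dist T).
Local Notation seg := (inseg T).
Local Notation "g @ v" := (act A g v) (at level 35, right associativity).
Variables (s : vert T) (c : bool -> G) (k : nat).

(** Combinatorial form of the overlap clause of small cancellation: since [p = g @ p'], the
    conclusion says that [g] fixes the ends of the overlap. *)
Definition short_overlaps : Prop :=
  forall i j g p q p' q', seg s (c i @ s) p -> seg s (c i @ s) q ->
    seg s (c j @ s) p' -> seg s (c j @ s) q' -> p = g @ p' -> q = g @ q' ->
    k < d p q -> i = j /\ p = p' /\ q = q'.

Hypothesis SO : short_overlaps.
Hypothesis Long : forall i, 4 * k + 1 <= d s (c i @ s).

Lemma act_inj g u v : g @ u = g @ v -> u = v.
Proof. intro E. rewrite <- (act_invK G T A g u), E. apply act_invK. Qed.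

Fixpoint wval (w : list bool) : G :=
  (match w with [] => 1 | i :: w => c i * wval w end)%G.

Lemma wval_app u v : wval (u ++ v) = (wval u * wval v)%G.
Proof. induction u as [|i u IH]; simpl; [now gsimp|now rewrite IH, gmulA]. Qed.

Lemma wval_one i : wval [i] = c i.
Proof. apply gmulr1. Qed.

Local Notation D w := (d s (wval w @ s)).

Lemma D_nil : D [] = 0.
Proof. simpl. rewrite act_one. now apply tdist_refl. Qed.

Lemma D_translate u v : d (wval u @ s) (wval (u ++ v) @ s) = D v.
Proof. rewrite wval_app, act_mul. now apply tdist_act. Qed.

(** A leg longer than [k] at [c i @ s] would be an overlap of the first segment with the translate
    by [c i] of the second. Short overlaps would then force [c i @ s = s]. *)
Lemma flat_letters i j : D [i] + D [j] <= D [i; j] + 2 * k.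
Proof.
  assert (E := D_translate [i] [j]). simpl app in E.
  destruct (median T HT s (wval [i] @ s) (wval [i; j] @ s)) as (o & S1 & S2 & S3).
  destruct (Nat.le_gt_cases (d (wval [i] @ s) o) k) as [L|L].
  - unfold inseg in S1, S2, S3. rewrite (tdist_sym T HT o (wval [i] @ s)) in S1. lia.
  - exfalso. rewrite wval_one in *.
    assert (S3' : seg s (c j @ s) ((c i)^-1%G @ o)).
    { apply (inseg_act G T A HT (c i)). rewrite act_Kinv, <- act_mul.
      simpl in S3. now rewrite gmulr1 in S3. }
    destruct (SO i j (c i) (c i @ s) o s ((c i)^-1%G @ o)) as (_ & X & _);
      auto using seg_left, seg_right.
    + now rewrite act_Kinv.
    + assert (Y := Long i). rewrite X, tdist_refl in Y; auto. lia.
Qed.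

(* Local-to-global: turns of length at most k at both ends of a segment longer
   than 2k leave the middle of the segment on the geodesic. *)
Lemma flat_step u i v : D u + D [i] <= D (u ++ [i]) + 2 * k ->
  D [i] + D v <= D (i :: v) + 2 * k ->
  D u + D (i :: v) <= D (u ++ i :: v) + 2 * k /\
  D (u ++ [i]) + D v <= D (u ++ i :: v) + 2 * k.
Proof.
  intros F1 F2.
  assert (E1 := D_translate u [i]). assert (E2 := D_translate u (i :: v)).
  assert (E3 := D_translate (u ++ [i]) v). rewrite <- app_assoc in E3. simpl app in E3.
  assert (L := Long i). rewrite <- wval_one in L.
  destruct (four_point T HT s (wval (u ++ [i]) @ s) (wval u @ s) (wval (u ++ i :: v) @ s)) as [Q|Q];
    rewrite ?(tdist_sym T HT (wval (u ++ [i]) @ s) (wval u @ s)) in Q; lia.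
Qed.

Lemma flat_letter_word i w : D [i] + D w <= D (i :: w) + 2 * k.
Proof.
  revert i. induction w as [|j w IH]; intro i.
  - rewrite D_nil. lia.
  - apply (flat_step [i] j w); auto. apply flat_letters.
Qed.

Lemma flat_words u v : D u + D v <= D (u ++ v) + 2 * k.
Proof.
  revert v. induction u as [|i u IH] using rev_ind; intro v.
  - rewrite D_nil. simpl app. lia.
  - rewrite <- app_assoc. simpl app. apply flat_step; auto using flat_letter_word.
Qed.

(** A letter contributes at least 4k+1 and a junction loses at most 2k. *)
Lemma D_length w : (2 * k + 1) * length w <= D w.
Proof.
  induction w as [|i w IH]; [simpl; lia|].
  assert (F := flat_letter_word i w). assert (L := Long i). rewrite <- wval_one in L.
  cbn [length]. nia.
Qed.

Lemma D_last w i : D [i] <= D (w ++ [i]).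
Proof.
  assert (F := flat_words w [i]). assert (L := D_length w).
  destruct w as [|j w]; [simpl app; lia|]. cbn [length] in L. nia.
Qed.

(** The part of a letter segment that backtracking at the two neighbouring junctions cannot remove;
    it survives on the geodesic of every word, see [core_on_geodesic]. *)
Definition in_core (i : bool) (r : vert T) : Prop :=
  seg s (c i @ s) r /\ k <= d s r /\ k <= d r (c i @ s).

Lemma core_on_geodesic u i v r : in_core i r ->
  seg s (wval (u ++ i :: v) @ s) (wval u @ r) /\
  d s (wval u @ r) + d r (c i @ s) = D (u ++ [i]).
Proof.
  intros (S & L1 & L2).
  assert (S' : seg (wval u @ s) (wval (u ++ [i]) @ s) (wval u @ r)).
  { rewrite wval_app, act_mul, wval_one. now apply inseg_act. }
  assert (E1 : d (wval u @ s) (wval u @ r) = d s r) by now apply tdist_act.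
  assert (E2 : d (wval u @ r) (wval (u ++ [i]) @ s) = d r (c i @ s)).
  { rewrite wval_app, act_mul, wval_one. now apply tdist_act. }
  assert (S2 : seg s (wval (u ++ [i]) @ s) (wval u @ r)).
  { apply (seg_trim T HT k s (wval u @ s)); auto; [|lia].
    rewrite D_translate. apply flat_words. }
  split.
  - apply inseg_sym, (seg_trim T HT k _ (wval (u ++ [i]) @ s)); auto using inseg_sym.
    + assert (F := flat_words (u ++ [i]) v). assert (E3 := D_translate (u ++ [i]) v).
      rewrite <- app_assoc in F, E3. simpl app in F, E3.
      rewrite (tdist_sym T HT _ (wval (u ++ [i]) @ s)), (tdist_sym T HT _ s), (tdist_sym T HT _ s). lia.
    + rewrite tdist_sym by auto. lia.
  - rewrite <- E2. exact S2.
Qed.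

(** In a tree the geodesic lies inside the broken path of letter segments; [edge_split] at the end
    of the first letter gives the induction. *)
Lemma edge_covered w z z' : seg s (wval w @ s) z -> seg s (wval w @ s) z' -> d z z' = 1 ->
  exists u i v, w = u ++ i :: v /\
    seg (wval u @ s) (wval (u ++ [i]) @ s) z /\ seg (wval u @ s) (wval (u ++ [i]) @ s) z'.
Proof.
  revert z z'. induction w as [|i w IH]; intros z z' S S' E.
  - exfalso. unfold inseg in *. rewrite D_nil in *.
    rewrite <- (tdist0_eq T HT s z), <- (tdist0_eq T HT s z'), tdist_refl in E; auto; lia.
  - destruct (edge_split T HT _ _ (c i @ s) _ _ S S' E) as [[X X']|[X X']].
    + exists [], i, w. simpl. rewrite act_one, gmulr1. auto.
    + simpl in X, X'. rewrite act_mul in X, X'.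
      rewrite <- (act_Kinv G T A (c i) z), inseg_act in X by auto.
      rewrite <- (act_Kinv G T A (c i) z'), inseg_act in X' by auto.
      destruct (IH _ _ X X') as (u & j & v & -> & Y & Y').
      { rewrite tdist_act; auto. }
      exists (i :: u), j, v. split; [reflexivity|]. simpl. rewrite !act_mul.
      rewrite <- (inseg_act G T A HT (c i)), act_Kinv in Y, Y'. auto.
Qed.

Lemma exists_core i : exists p q, in_core i p /\ in_core i q /\
  d s p = k /\ d q (c i @ s) = k /\ d p q + 2 * k = d s (c i @ s).
Proof.
  assert (L := Long i).
  destruct (point_at T HT s (c i @ s) k) as (p & S1 & D1); [lia|].
  destruct (point_at T HT s (c i @ s) (d s (c i @ s) - k)) as (q & S2 & D2); [lia|].
  assert (C := seg_collinear T HT _ _ p q S1 S2 ltac:(lia)).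
  exists p, q. unfold in_core. unfold inseg in *. repeat split; lia.
Qed.

(** * Marks: translates of the core of [c true], and where they occur *)

Variables p q : vert T.
Hypothesis Cp : in_core true p.
Hypothesis Cq : in_core true q.
Hypothesis Dp : d s p = k.
Hypothesis Dq : d q (c true @ s) = k.
Hypothesis Dpq : d p q + 2 * k = d s (c true @ s).

Lemma core_length : 2 * k + 1 <= d p q.
Proof. assert (L := Long true). lia. Qed.

(** The two marks share the stretch from [h @ p] to [g @ q], longer than [k], so short overlaps make
    [g^-1 h] fix [p]. *)
Lemma mark_overlap x y g h : seg x y (g @ p) -> seg x y (g @ q) ->
  seg x y (h @ p) -> seg x y (h @ q) -> d x (g @ p) < d x (g @ q) -> d x (h @ p) < d x (h @ q) ->
  d x (g @ p) <= d x (h @ p) -> d x (h @ p) + k < d x (g @ q) -> g @ p = h @ p.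
Proof.
  intros S1 S2 S3 S4 L1 L2 L3 L4.
  assert (C1 := line_dist T HT _ _ _ _ S1 S2). assert (C2 := line_dist T HT _ _ _ _ S3 S4).
  rewrite tdist_act in C1, C2 by auto.
  assert (C3 := line_dist T HT _ _ _ _ S3 S2).
  assert (X1 : seg (g @ p) (g @ q) (h @ p)) by (apply (seg_between T HT x y); auto; lia).
  assert (X2 : seg (h @ p) (h @ q) (g @ q)) by (apply (seg_between T HT x y); auto; lia).
  destruct Cp as [Sp _], Cq as [Sq _].
  rewrite <- (act_Kinv G T A g (h @ p)), inseg_act in X1 by auto.
  rewrite <- (act_Kinv G T A h (g @ q)), inseg_act in X2 by auto.
  destruct (SO true true (g^-1 * h)%G (g^-1%G @ h @ p) q p (h^-1%G @ g @ q)) as (_ & E & _); auto.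
  - exact (seg_convex T HT _ _ _ _ _ Sp Sq X1).
  - exact (seg_convex T HT _ _ _ _ _ Sp Sq X2).
  - now rewrite act_mul.
  - now rewrite act_mul, act_Kinv, act_invK.
  - rewrite <- (tdist_act G T A HT g), act_Kinv. lia.
  - rewrite <- E at 1. now rewrite act_Kinv.
Qed.

(** The stretch from [r1] to [r2] has length at least 2k+1, so it starts [k] before the edge or ends
    [k] after it. The edge together with [k] more steps on that side is the common part. *)
Lemma common_overlap x y m0 m1 x1 x2 lo hi r1 r2 :
  seg x y m0 -> seg x y m1 -> seg x y lo -> seg x y hi -> seg x y r1 -> seg x y r2 ->
  seg x1 x2 lo -> seg x1 x2 hi -> seg x1 x2 r1 -> seg x1 x2 r2 ->
  d x hi = S (d x lo) -> d x m0 + k <= d x lo -> d x hi + k <= d x m1 ->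
  d x r1 + 2 * k + 1 <= d x r2 ->
  exists y1 y2, seg x y y1 /\ seg x y y2 /\ seg m0 m1 y1 /\ seg m0 m1 y2 /\
    seg x1 x2 y1 /\ seg x1 x2 y2 /\ k < d y1 y2.
Proof.
  intros M0 M1 Lo Hi R1 R2 Lo' Hi' R1' R2' E1 E2 E3 E4.
  assert (B0 : d x m0 <= d x y /\ d x m1 <= d x y) by (unfold inseg in *; lia).
  destruct (Nat.le_gt_cases (d x r1 + k) (d x lo)) as [L|L].
  - destruct (point_at T HT x y (d x lo - k)) as (t & St & Dt); [lia|].
    exists t, hi. assert (C := seg_collinear T HT x y t hi St Hi ltac:(lia)).
    repeat split; auto; try (apply (seg_between T HT x y); auto; lia); [|lia].
    apply (seg_convex T HT _ _ r1 lo); auto. apply (seg_between T HT x y); auto; lia.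
  - destruct (point_at T HT x y (d x hi + k)) as (t & St & Dt); [lia|].
    exists lo, t. assert (C := seg_collinear T HT x y lo t Lo St ltac:(lia)).
    repeat split; auto; try (apply (seg_between T HT x y); auto; lia); [|lia].
    apply (seg_convex T HT _ _ hi r2); auto. apply (seg_between T HT x y); auto; lia.
Qed.

Lemma same_distances x y u v y1 y2 : seg x y u -> seg x y v -> seg x y y1 -> seg x y y2 ->
  0 < d y1 y2 -> d u y1 = d v y1 -> d u y2 = d v y2 -> u = v.
Proof.
  intros Su Sv S1 S2 L E1 E2. apply (seg_unique T HT x y); auto.
  assert (C1 := line_dist T HT _ _ _ _ Su S1). assert (C2 := line_dist T HT _ _ _ _ Su S2).
  assert (C3 := line_dist T HT _ _ _ _ Sv S1). assert (C4 := line_dist T HT _ _ _ _ Sv S2).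
  assert (C5 := line_dist T HT _ _ _ _ S1 S2). lia.
Qed.

(** An inner edge of the mark lies in some letter segment. The mark and that segment then share more
    than [k], and short overlaps identify the letter as [true] and the mark as the one of that
    letter, with its orientation. *)
Lemma mark_in_word w g : seg s (wval w @ s) (g @ p) -> seg s (wval w @ s) (g @ q) ->
  exists u v, w = u ++ true :: v /\ g @ p = wval u @ p /\ g @ q = wval u @ q.
Proof.
  intros S1 S2. assert (CL := core_length).
  set (y := wval w @ s) in *.
  assert (E : d (g @ p) (g @ q) = d p q) by now apply tdist_act.
  (* As the mark has length at least 2k+1, the edge at depth [k] stays [k] away from both of its
     ends. *)
  destruct (point_at T HT (g @ p) (g @ q) k) as (z & Z & Dz); [lia|].
  destruct (point_at T HT (g @ p) (g @ q) (S k)) as (z' & Z' & Dz'); [lia|].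
  assert (Ez := seg_collinear T HT _ _ z z' Z Z' ltac:(lia)).
  assert (Y := seg_convex T HT _ _ _ _ _ S1 S2 Z).
  assert (Y' := seg_convex T HT _ _ _ _ _ S1 S2 Z').
  destruct (edge_covered w z z') as (u & i & v & Ew & K & K'); auto; [lia|].
  destruct (exists_core i) as (pi & qi & Ci & Ci' & E1 & E2 & E3).
  destruct (core_on_geodesic u i v pi Ci) as [R1 F1].
  destruct (core_on_geodesic u i v qi Ci') as [R2 F2].
  rewrite <- Ew in R1, R2. fold y in R1, R2.
  assert (Li := Long i).
  assert (Si := proj1 Ci). assert (Si' := proj1 Ci').
  rewrite wval_app, act_mul, wval_one in K, K'.
  assert (Ki : seg (wval u @ s) (wval u @ c i @ s) (wval u @ pi)) by now apply inseg_act.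
  assert (Ki' : seg (wval u @ s) (wval u @ c i @ s) (wval u @ qi)) by now apply inseg_act.
  assert (exists y1 y2, seg s y y1 /\ seg s y y2 /\
    seg (g @ p) (g @ q) y1 /\ seg (g @ p) (g @ q) y2 /\
    seg (wval u @ s) (wval u @ c i @ s) y1 /\ seg (wval u @ s) (wval u @ c i @ s) y2 /\
    k < d y1 y2) as (y1 & y2 & Y1 & Y2 & P1 & P2 & Q1 & Q2 & LY).
  { assert (C1 := line_dist T HT _ _ _ _ S1 Y). assert (C2 := line_dist T HT _ _ _ _ S1 Y').
    assert (C3 := line_dist T HT _ _ _ _ Y Y'). assert (C4 := line_dist T HT _ _ _ _ S1 S2).
    assert (C5 := line_dist T HT _ _ _ _ Y S2). assert (C6 := line_dist T HT _ _ _ _ Y' S2).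
    unfold inseg in Si, Si', Z, Z'.
    (* The mark might still run backwards along the geodesic. *)
    destruct (Nat.le_gt_cases (d s (g @ p)) (d s (g @ q))) as [L|L].
    - apply (common_overlap s y (g @ p) (g @ q) (wval u @ s) (wval u @ c i @ s)
        z z' (wval u @ pi) (wval u @ qi)); auto; lia.
    - destruct (common_overlap s y (g @ q) (g @ p) (wval u @ s) (wval u @ c i @ s)
        z' z (wval u @ pi) (wval u @ qi)) as (y1 & y2 & ?); auto; try lia.
      exists y1, y2. intuition auto using inseg_sym. }
  destruct Cp as [Sp _], Cq as [Sq _].
  rewrite <- (act_Kinv G T A g y1), inseg_act in P1 by auto.
  rewrite <- (act_Kinv G T A g y2), inseg_act in P2 by auto.
  rewrite <- (act_Kinv G T A (wval u) y1), inseg_act in Q1 by auto.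
  rewrite <- (act_Kinv G T A (wval u) y2), inseg_act in Q2 by auto.
  destruct (SO i true ((wval u)^-1 * g)%G ((wval u)^-1%G @ y1) ((wval u)^-1%G @ y2)
    (g^-1%G @ y1) (g^-1%G @ y2)) as (-> & X1 & X2); auto.
  - exact (seg_convex T HT _ _ _ _ _ Sp Sq P1).
  - exact (seg_convex T HT _ _ _ _ _ Sp Sq P2).
  - now rewrite act_mul, act_Kinv.
  - now rewrite act_mul, act_Kinv.
  - now rewrite tdist_act.
  - exists u, v. split; auto.
    (* The points [y1] and [y2] have equal preimages under [g] and [wval u], so both copies of [p]
       (and of [q]) lie at the same distances from them, which determines positions on a
       geodesic. *)
    assert (E' : forall r r', (wval u)^-1%G @ r' = g^-1%G @ r' -> d (g @ r) r' = d (wval u @ r) r').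
    { intros r r' X. rewrite <- (act_Kinv G T A g r') at 1.
      rewrite <- (act_Kinv G T A (wval u) r') at 2. now rewrite !tdist_act, X. }
    split; apply (same_distances s y _ _ y1 y2); auto; try lia;
      subst y w; now apply core_on_geodesic.
Qed.

(** A pair of consecutive, equally oriented marks whose starts are [r] apart, recorded by the start
    of the first and the end of the second. The last clause makes them consecutive and only refers
    to marks inside the segment, so occurrences do not depend on the surrounding geodesic. *)
Definition gap_pattern (r : nat) : pattern T := fun u w => exists g h,
  u = g @ p /\ w = h @ q /\ seg u w (g @ q) /\ seg u w (h @ p) /\ d u (h @ p) = r /\
  forall f, seg u w (f @ p) -> seg u w (f @ q) -> d u (f @ p) < d u (f @ q) ->
    d u (f @ p) = 0 \/ r <= d u (f @ p).

Lemma gap_pattern_long r u w : gap_pattern r u w -> r <= d u w.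
Proof. intros (g & h & _ & _ & _ & S & <- & _). unfold inseg in S. lia. Qed.

Lemma gap_pattern_irrefl r u : ~ gap_pattern r u u.
Proof.
  intros (g & h & -> & _ & S & _). unfold inseg in S. assert (C := core_length).
  rewrite tdist_act, (tdist_refl T HT (g @ p)) in S; auto. lia.
Qed.

Lemma gap_pattern_act_impl r f u w : gap_pattern r u w -> gap_pattern r (f @ u) (f @ w).
Proof.
  intros (g & h & -> & -> & S1 & S2 & E & N).
  exists (f * g)%G, (f * h)%G. rewrite !act_mul, !inseg_act, tdist_act by auto.
  repeat split; auto. intros f' T1 T2 L.
  rewrite <- (act_Kinv G T A f (f' @ p)), inseg_act, ?tdist_act in T1 by auto.
  rewrite <- (act_Kinv G T A f (f' @ q)), inseg_act, ?tdist_act in T2 by auto.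
  rewrite <- (act_Kinv G T A f (f' @ p)), <- (act_Kinv G T A f (f' @ q)), !tdist_act in L by auto.
  rewrite <- (act_Kinv G T A f (f' @ p)), tdist_act by auto.
  specialize (N (f^-1 * f')%G). rewrite !act_mul in N. auto.
Qed.

Lemma gap_pattern_act r f u w : gap_pattern r (f @ u) (f @ w) <-> gap_pattern r u w.
Proof.
  split; [|apply gap_pattern_act_impl]. intro P.
  apply (gap_pattern_act_impl r (f^-1)%G) in P. now rewrite !act_invK in P.
Qed.

(* [u, v, w] are the starts of the two marks of the pattern and the end of the second. *)
Definition gap_on_line (r : nat) (x y : vert T) (u v w : nat) : Prop := exists g h,
  seg x y (g @ p) /\ seg x y (g @ q) /\ seg x y (h @ p) /\ seg x y (h @ q) /\
  u = d x (g @ p) /\ v = d x (h @ p) /\ w = d x (h @ q) /\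
  u + d p q = d x (g @ q) /\ v + d p q = w /\ u + r = v /\
  forall f, seg x y (f @ p) -> seg x y (f @ q) -> d x (f @ p) + d p q = d x (f @ q) ->
    u < d x (f @ p) < v -> False.

Lemma gap_pattern_on_line r x y v0 w0 : seg x y v0 -> seg x y w0 -> d x v0 < d x w0 ->
  gap_pattern r v0 w0 ->
  gap_on_line r x y (d x v0) (d x v0 + r) (d x w0) /\
  exists g h, v0 = g @ p /\ w0 = h @ q /\ seg x y (g @ q) /\ seg x y (h @ p) /\
    d x (h @ p) = d x v0 + r.
Proof.
  intros S1 S2 L (g & h & -> & -> & S3 & S4 & E & N).
  assert (S5 := seg_convex T HT _ _ _ _ _ S1 S2 S3).
  assert (S6 := seg_convex T HT _ _ _ _ _ S1 S2 S4).
  assert (C := core_length).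
  assert (Eg : d (g @ p) (g @ q) = d p q) by now apply tdist_act.
  assert (Eh : d (h @ p) (h @ q) = d p q) by now apply tdist_act.
  assert (C1 := line_dist T HT _ _ _ _ S1 S2). assert (C2 := line_dist T HT _ _ _ _ S1 S5).
  assert (C3 := line_dist T HT _ _ _ _ S1 S6). assert (C4 := line_dist T HT _ _ _ _ S2 S5).
  assert (C5 := line_dist T HT _ _ _ _ S2 S6).
  rewrite (tdist_sym T HT (h @ q) (g @ q)) in C4.
  rewrite (tdist_sym T HT (h @ q) (h @ p)) in C5.
  unfold inseg in S3, S4.
  split.
  - exists g, h. repeat split; auto; try lia.
    intros f F1 F2 EF LF.
    assert (C6 := line_dist T HT _ _ _ _ S1 F1). assert (C7 := line_dist T HT _ _ _ _ S1 F2).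
    destruct (N f); try lia; apply (seg_between T HT x y); auto; lia.
  - exists g, h. repeat split; auto; lia.
Qed.

(** Both pairs consist of consecutive marks, so neither interval between starts can contain a start
    of the other in its interior; sharing a point or a right end then forces them to coincide. *)
Lemma gap_unique r r' x y u v w u' v' w' : 0 < r -> 0 < r' ->
  gap_on_line r x y u v w -> gap_on_line r' x y u' v' w' ->
  v = v' \/ (exists o, u < o <= v /\ u' < o <= v') -> r = r'.
Proof.
  intros R R' (g & h & S1 & S2 & S3 & S4 & -> & -> & -> & E1 & E2 & E3 & N)
    (g' & h' & S1' & S2' & S3' & S4' & -> & -> & -> & E1' & E2' & E3' & N') I.
  assert (X1 := N g' S1' S2' E1'). assert (X2 := N h' S3' S4' E2').
  assert (X3 := N' g S1 S2 E1). assert (X4 := N' h S3 S4 E2).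
  destruct I as [I|[o I]]; lia.
Qed.

Lemma at_most_one (Q : nat -> Prop) : (forall j j', Q j -> Q j' -> j = j') ->
  exists b, length b <= 1 /\ forall j, Q j -> In j b.
Proof.
  intro U. destruct (classic (exists j, Q j)) as [[j Hj]|N].
  - exists [j]. split; auto. intros j' Hj'. left. auto.
  - exists []. split; auto. intros j Hj. exfalso. eauto.
Qed.

(** The point [o] lies between the two starts, in the first half of the second mark, or in its
    second half. Each position allows only one gap length, and the lengths are distinct, hence the
    bound three. *)
Lemma gap_crossings (R : nat -> nat) x y o :
  (forall j, 0 < R j) -> (forall j j', R j = R j' -> j = j') ->
  exists b, length b <= 3 /\ forall j, crosses T (gap_pattern (R j)) x y o -> In j b.
Proof.
  intros Pos Inj. assert (CL := core_length).
  (* Marks whose starts differ by less than half a mark overlap in more than [k], as a mark has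
     length at least 2k+1. *)
  assert (M : forall j j' u v w u' v' w', gap_on_line (R j) x y u v w ->
    gap_on_line (R j') x y u' v' w' ->
    v <= v' -> 2 * v' < 2 * v + d p q -> v = v').
  { intros j j' u v w u' v' w' (g & h & S1 & S2 & S3 & S4 & -> & -> & -> & E1 & E2 & E3 & N)
      (g' & h' & S1' & S2' & S3' & S4' & -> & -> & -> & E1' & E2' & E3' & N') L1 L2.
    f_equal. apply (mark_overlap x y); auto; lia. }
  destruct (at_most_one (fun j => exists u v w, gap_on_line (R j) x y u v w /\
    u < d x o <= v)) as (b1 & L1 & B1).
  { intros j j' (u & v & w & X & I) (u' & v' & w' & X' & I'). apply Inj.
    eapply gap_unique; eauto. }
  destruct (at_most_one (fun j => exists u v w, gap_on_line (R j) x y u v w /\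
    v < d x o /\ 2 * d x o <= 2 * v + d p q)) as (b2 & L2 & B2).
  { intros j j' (u & v & w & X & I) (u' & v' & w' & X' & I'). apply Inj.
    eapply gap_unique; eauto. left.
    destruct (Nat.le_ge_cases v v'); [|symmetry]; eapply M; eauto; lia. }
  destruct (at_most_one (fun j => exists u v w, gap_on_line (R j) x y u v w /\
    d x o < w /\ 2 * v + d p q < 2 * d x o)) as (b3 & L3 & B3).
  { intros j j' (u & v & w & X & I) (u' & v' & w' & X' & I'). apply Inj.
    eapply gap_unique; eauto. left.
    assert (v + d p q = w) by (destruct X as (? & ? & ?); tauto).
    assert (v' + d p q = w') by (destruct X' as (? & ? & ?); tauto).
    destruct (Nat.le_ge_cases v v'); [|symmetry]; eapply M; eauto; lia. }
  exists (b1 ++ b2 ++ b3). rewrite !length_app. split; [lia|].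
  intros j (v0 & w0 & S1 & S2 & P & L).
  destruct (gap_pattern_on_line _ _ _ _ _ S1 S2 ltac:(lia) P) as [X _].
  rewrite !in_app_iff.
  destruct (Nat.le_gt_cases (d x o) (d x v0 + R j)).
  - left. apply B1. do 3 eexists. split; [exact X|lia].
  - right. destruct (Nat.le_gt_cases (2 * d x o) (2 * (d x v0 + R j) + d p q)).
    + left. apply B2. do 3 eexists. split; [exact X|lia].
    + right. apply B3. do 3 eexists. split; [exact X|lia].
Qed.

(** * A word whose consecutive marks have pairwise distinct gaps *)

Definition gap (n : nat) : nat := d p (wval (true :: repeat false n) @ p).

Lemma gap_ge n : n <= gap n.
Proof.
  unfold gap. set (g := wval _).
  assert (L := D_length (true :: repeat false n)). cbn [length] in L.
  rewrite repeat_length in L. fold g in L.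
  assert (I1 := tdist_tri T HT s p (g @ s)). assert (I2 := tdist_tri T HT p (g @ p) (g @ s)).
  rewrite (tdist_act G T A HT g p s), (tdist_sym T HT p s) in I2. nia.
Qed.

Variable D0 : nat.

(** The exponents of the word. Since [gap n] is at least [n], taking each exponent above the
    previous gap makes the gaps strictly increasing, and the first exponent puts them all above
    [D0]. *)
Fixpoint block (j : nat) : nat :=
  match j with 0 => S D0 | S j => S (gap (block j)) end.

Lemma gap_block_lt i j : i < j -> gap (block i) < gap (block j).
Proof.
  induction 1 as [|j L IH].
  - assert (X := gap_ge (block (S i))). simpl in X |- *. lia.
  - assert (X := gap_ge (block (S j))). simpl in X |- *. lia.
Qed.

Lemma gap_block_inj i j : gap (block i) = gap (block j) -> i = j.
Proof.
  intro E. destruct (Nat.lt_trichotomy i j) as [L|[L|L]]; auto;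
  apply gap_block_lt in L; lia.
Qed.

Lemma gap_block_gt j : D0 < gap (block j).
Proof.
  destruct j as [|j].
  - assert (X := gap_ge (block 0)). simpl in X |- *. lia.
  - assert (Y := gap_block_lt 0 (S j) ltac:(lia)). assert (X := gap_ge (block 0)).
    simpl in X, Y |- *. lia.
Qed.

Fixpoint prefix (j : nat) : list bool :=
  match j with 0 => [] | S j => prefix j ++ true :: repeat false (block j) end.

Lemma true_before_block n x u v : x ++ repeat false n = u ++ true :: v ->
  exists v', x = u ++ true :: v'.
Proof.
  revert v. induction n as [|n IH]; intros v E.
  - rewrite app_nil_r in E. eauto.
  - cbn [repeat] in E. rewrite repeat_cons, app_assoc in E.
    induction v as [|b v _] using rev_ind.
    + apply app_inj_tail in E. now destruct E.
    + rewrite app_comm_cons, app_assoc in E. apply app_inj_tail in E.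
      apply (IH v), E.
Qed.

Lemma prefix_complete M u v : prefix M ++ [true] = u ++ true :: v ->
  exists i, i <= M /\ u = prefix i.
Proof.
  revert v. induction M as [|M IH]; intros v E; induction v as [|b v _] using rev_ind.
  - exists 0. apply app_inj_tail in E. now destruct E.
  - destruct u; simpl in E; [now destruct v|]. now destruct u.
  - exists (S M). apply app_inj_tail in E. now destruct E.
  - rewrite app_comm_cons, app_assoc in E. apply app_inj_tail in E as [E _].
    simpl in E. change (true :: repeat false (block M)) with ([true] ++ repeat false (block M)) in E.
    rewrite app_assoc in E. apply true_before_block in E as [v' E].
    destruct (IH v' E) as (i & L & ->). exists i. split; auto.
Qed.

Lemma prefix_extends i j : i < j -> exists v, prefix j = prefix i ++ true :: v.
Proof.
  induction 1 as [|j L (v & IH)]; simpl.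
  - eauto.
  - rewrite IH, <- app_assoc. simpl. eauto.
Qed.

Variable M : nat.
Local Notation W := (prefix M ++ [true]).
Local Notation endp := (wval W @ s).
Local Notation start i := (wval (prefix i) @ p).
Local Notation stop i := (wval (prefix i) @ q).

Lemma prefix_word i : i <= M -> exists v, W = prefix i ++ true :: v.
Proof.
  intro L. destruct (Nat.eq_dec i M) as [->|]; [eauto|].
  destruct (prefix_extends i M) as [v E]; [lia|]. rewrite E, <- app_assoc. simpl. eauto.
Qed.

Lemma start_on_line i : i <= M -> seg s endp (start i) /\ seg s endp (stop i) /\
  d s (start i) + d p q = d s (stop i).
Proof.
  intro L. destruct (prefix_word i L) as [v E].
  destruct (core_on_geodesic (prefix i) true v p Cp) as [S1 E1].
  destruct (core_on_geodesic (prefix i) true v q Cq) as [S2 E2].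
  rewrite <- E in S1, S2. repeat split; auto.
  destruct Cp as [Sp _]. unfold inseg in Sp. lia.
Qed.

Lemma start_lt i j : i < j -> d s (start i) < d s (start j).
Proof.
  intro L. destruct (prefix_extends i j L) as [v E].
  destruct (core_on_geodesic (prefix i) true [] p Cp) as [_ E1].
  destruct (core_on_geodesic (prefix j) true [] p Cp) as [_ E2].
  assert (F := flat_words (prefix i ++ [true]) (v ++ [true])).
  rewrite <- app_assoc in F. simpl app in F.
  rewrite E, <- app_assoc in E2. simpl app in E2. rewrite E.
  assert (F' := D_last v true). rewrite wval_one in F'.
  assert (X := Long true). destruct Cp as [Sp _]. unfold inseg in Sp. lia.
Qed.

Lemma start_le_inv i j : d s (start i) <= d s (start j) -> i <= j.
Proof.
  intro L. destruct (Nat.le_gt_cases i j) as [|X]; auto. apply start_lt in X. lia.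
Qed.

Lemma start_lt_inv i j : d s (start i) < d s (start j) -> i < j.
Proof.
  intro L. destruct (Nat.le_gt_cases j i) as [X|]; auto.
  destruct (Nat.eq_dec i j) as [->|]; [lia|]. assert (Y := start_lt j i ltac:(lia)). lia.
Qed.

Lemma start_gap i : S i <= M -> d s (start (S i)) = d s (start i) + gap (block i).
Proof.
  intro L. destruct (start_on_line i) as (S1 & _); [lia|].
  destruct (start_on_line (S i)) as (S2 & _); [lia|].
  assert (X := start_lt i (S i) ltac:(lia)).
  assert (C := seg_collinear T HT _ _ _ _ S1 S2 ltac:(lia)).
  rewrite <- C. f_equal. unfold gap. cbn [prefix].
  rewrite wval_app, act_mul. now apply tdist_act.
Qed.

Lemma mark_is_start g : seg s endp (g @ p) -> seg s endp (g @ q) ->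
  exists i, i <= M /\ g @ p = start i /\ g @ q = stop i.
Proof.
  intros S1 S2. destruct (mark_in_word _ g S1 S2) as (u & v & E & E1 & E2).
  destruct (prefix_complete _ _ _ E) as (i & L & ->). eauto.
Qed.

(** By [mark_is_start] the only marks on the geodesic are the visible ones, all running forwards, so
    every occurrence joins neighbouring starts and its length reveals the index. *)
Lemma gap_pattern_once j : j < M -> occurs_once T (gap_pattern (gap (block j))) s endp.
Proof.
  intro Hj. assert (CL := core_length).
  destruct (start_on_line j) as (S1 & S2 & E1); [lia|].
  destruct (start_on_line (S j)) as (S3 & S4 & E2); [lia|].
  assert (E3 := start_gap j Hj).
  exists (start j). split; [|split; [|split]]; auto.
  - exists (stop (S j)). split.
    + apply (seg_between T HT s endp); auto using seg_right. unfold inseg in S4. lia.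
    + exists (wval (prefix j)), (wval (prefix (S j))).
      assert (C := seg_collinear T HT _ _ _ _ S1 S3 ltac:(lia)).
      assert (C2 := start_lt j (S j) ltac:(lia)).
      assert (C3 := seg_collinear T HT _ _ _ _ S2 S3).
      split; [auto|split; [auto|split; [|split; [|split]]]].
      * apply (seg_between T HT s endp); auto. split; [lia|].
        destruct (Nat.le_gt_cases (d s (stop j)) (d s (stop (S j)))); auto; lia.
      * apply (seg_between T HT s endp); auto; lia.
      * lia.
      * intros f F1 F2 LF.
        assert (G1 := seg_convex T HT _ _ _ _ _ S1 S4 F1).
        assert (G2 := seg_convex T HT _ _ _ _ _ S1 S4 F2).
        destruct (mark_is_start f G1 G2) as (i & Hi & Ei & _). rewrite Ei in *.
        assert (C4 := line_dist T HT _ _ _ _ S1 G1).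
        assert (C5 := line_dist T HT _ _ _ _ S1 S4).
        assert (C6 := line_dist T HT _ _ _ _ G1 S4). unfold inseg in F1.
        destruct (Nat.eq_dec (d (start j) (start i)) 0) as [|NZ]; auto. right.
        destruct (Nat.le_gt_cases (gap (block j)) (d (start j) (start i))) as [|LG]; auto.
        assert (j < i) by (apply start_lt_inv; lia).
        assert (i < S j) by (apply start_lt_inv; lia). lia.
  - intros v0 w0 Sv Sw P.
    assert (Sw' := proj1 (seg_trans_r T HT _ _ _ _ Sv Sw)).
    assert (X : d s v0 < d s w0).
    { assert (Y := gap_pattern_long _ _ _ P). assert (Z := gap_block_gt j).
      assert (Sw2 := proj2 (seg_trans_r T HT _ _ _ _ Sv Sw)). unfold inseg in Sw2. lia. }
    destruct (gap_pattern_on_line _ _ _ _ _ Sv Sw' X P) as [_ (g & h & -> & -> & H1 & H2 & H3)].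
    assert (Q := P). destruct (gap_pattern_on_line _ _ _ _ _ Sv Sw' X Q)
      as [(g' & h' & _ & _ & _ & _ & _ & _ & _ & _ & _ & _ & N) _].
    destruct (mark_is_start g Sv H1) as (i & Hi & Ei & _).
    destruct (mark_is_start h H2 Sw') as (i' & Hi' & Ei' & _).
    rewrite Ei in *. rewrite Ei' in *.
    assert (i < i') by (apply start_lt_inv; assert (Z := gap_block_gt j); lia).
    destruct (start_on_line (S i)) as (T1 & T2 & T3); [lia|].
    (* The next start cannot lie strictly between the two marks, so the second mark is number [S i];
       injectivity of the gaps then gives [i = j]. *)
    assert (Z := start_lt i (S i) ltac:(lia)).
    assert (NI := N _ T1 T2 T3).
    assert (i' <= S i) by (apply start_le_inv; lia).
    replace i' with (S i) in * by lia. rewrite start_gap in H3 by lia.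
    f_equal. f_equal. f_equal. apply gap_block_inj. lia.
  (* A pattern read towards [s] would begin with a mark running backwards. *)
  - intros v0 w0 Sv Sw (g & h & -> & -> & H1 & _).
    assert (Sq := proj1 (seg_trans_l T HT _ _ _ _ Sv (inseg_sym T HT _ _ _ Sw))).
    assert (Sg := seg_convex T HT _ _ _ _ _ Sv Sq H1).
    destruct (mark_is_start g Sv Sg) as (i & Hi & Ei & Ei').
    destruct (start_on_line i Hi) as (T1 & T2 & T3).
    rewrite Ei, Ei' in *.
    assert (C1 := line_dist T HT _ _ _ _ Sv Sg).
    assert (C2 := line_dist T HT _ _ _ _ Sv Sq).
    assert (C3 := line_dist T HT _ _ _ _ Sg Sq).
    unfold inseg in H1, Sw. rewrite (tdist_sym T HT _ s), (tdist_sym T HT _ s) in Sw. lia.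
Qed.

End Generators.

Lemma short_overlaps_encodable (G : Group) (T : Tree) (A : Action G T) (s : vert T)
  (c : bool -> G) (k : nat) : is_tree T -> short_overlaps G T A s c k ->
  (forall i, 4 * k + 1 <= Defs.dist T s (act A (c i) s)) ->
  forall M, encodable A s M.
Proof.
  intros HT SO Long M D.
  destruct (exists_core G T A HT s c k Long true) as (p & q & Cp & Cq & E1 & E2 & E3).
  exists (fun j => gap_pattern G T A p q (gap G T A c p (block G T A c p D j))).
  exists (wval G c (prefix G T A c p D M ++ [true])).
  split; [split; [|split]|split].
  - intros j v. eapply (gap_pattern_irrefl G T A HT s c k Long p q E1 E2 E3).
  - intros j g v w. apply gap_pattern_act; auto.
  - intros x y o _.
    destruct (gap_crossings G T A HT s c k SO Long p q Cp Cq E1 E2 E3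
      (fun j => gap G T A c p (block G T A c p D j)) x y o) as (b & L & B).
    + intro j. assert (X := gap_block_gt G T A HT s c k SO Long p q E1 E2 E3 D j). lia.
    + apply (gap_block_inj G T A HT s c k SO Long p q E1 E2 E3 D).
    + exists b. auto.
  - intros j v w P.
    assert (Y := gap_pattern_long G T A s c k p q E1 E2 E3 _ _ _ P).
    assert (X := gap_block_gt G T A HT s c k SO Long p q E1 E2 E3 D j). lia.
  - intros j Hj. now apply (gap_pattern_once G T A HT s c k SO Long p q Cp Cq E1 E2 E3).
Qed.

(** * Weak small cancellation *)

Lemma ptdist_nonneg (T : Tree) (x y : point T) :
  valid_point T x -> valid_point T y -> (0 <= ptdist T x y)%R.
Proof.
  assert (P : forall u v, (0 <= dV T u v)%R) by (intros; apply pos_INR).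
  destruct x as [x|u v t], y as [y|u' v' t']; simpl; intros Hx Hy; auto.
  - assert (P1 := P u' x). assert (P2 := P v' x). apply Rmin_glb; lra.
  - assert (P1 := P u y). assert (P2 := P v y). apply Rmin_glb; lra.
  - assert (P1 := P u u'). assert (P2 := P u v'). assert (P3 := P v u'). assert (P4 := P v v').
    destruct excluded_middle_informative; [apply Rabs_pos|].
    destruct excluded_middle_informative; [apply Rabs_pos|].
    repeat apply Rmin_glb; lra.
Qed.

Lemma valid_act (G : Group) (T : Tree) (A : Action G T) g x :
  valid_point T x -> valid_point T (act_pt A g x).
Proof. destruct x as [x|u v t]; simpl; auto. now rewrite <- act_adj. Qed.

Lemma glb_exists (E : R -> Prop) b : (exists x, E x) -> (forall x, E x -> (b <= x)%R) ->
  exists r, is_glb E r.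
Proof.
  intros [x0 H0] HB.
  destruct (completeness (fun x => E (- x)%R)) as [m [M1 M2]].
  - exists (- b)%R. intros x Hx. specialize (HB _ Hx). lra.
  - exists (- x0)%R. now rewrite Ropp_involutive.
  - exists (- m)%R. split.
    + intros x Hx. assert (- x <= m)%R; [|lra]. apply M1. now rewrite Ropp_involutive.
    + intros c Hc. assert (m <= - c)%R; [|lra]. apply M2. intros x Hx. specialize (Hc _ Hx). lra.
Qed.

(** Since [tl] is picked by [epsilon], an infimum must first be shown to exist; nonnegativity of
    [ptdist] supplies the lower bound. *)
Lemma tl_le_displacement (G : Group) (T : Tree) (A : Action G T) (g : G) (v : vert T) :
  (Defs.tl A g <= dV T v (act A g v))%R.
Proof.
  unfold Defs.tl.
  set (E := fun r : R => exists p : point T, valid_point T p /\ r = ptdist T p (act_pt A g p)).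
  assert (Ev : E (dV T v (act A g v))) by now exists (PV v).
  assert (S : is_glb E (epsilon (inhabits 0%R) (is_glb E))).
  { apply epsilon_spec, (glb_exists E 0%R); [eauto|].
    intros r (x & Hx & ->). apply ptdist_nonneg; auto using valid_act. }
  now apply S.
Qed.

Lemma floor_nat (r : R) : (0 <= r)%R -> exists k, (INR k <= r < INR k + 1)%R.
Proof.
  intro H. destruct (archimed r) as [A1 A2].
  assert (0 < up r)%Z by (apply lt_IZR; lra).
  exists (Z.to_nat (up r - 1)). rewrite INR_IZR_INZ, Z2Nat.id, minus_IZR by lia. lra.
Qed.

Lemma small_cancellation_short_overlaps (G : Group) (T : Tree) (A : Action G T) (a b : G) :
  is_tree T -> weak_small_cancellation A 11 [a; b] ->
  exists s k, short_overlaps G T A s (fun i : bool => if i then a else b) k /\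
    forall i : bool, 4 * k + 1 <= Defs.dist T s (act A (if i then a else b) s).
Proof.
  intros HT (s & Far & Near & Overlap). cbv zeta in *.
  set (mt := minR (map (Defs.tl A) [a; b])) in *. cbn [length] in *.
  set (c := fun i : bool => if i then a else b).
  set (n := fun i : bool => if i then 0 else 1).
  assert (Ec : forall i, nth (n i) [a; b] (gone G) = c i) by (intros []; reflexivity).
  assert (Hn : forall i, n i < 2) by (intros []; simpl; lia).
  assert (Hm : forall i, (mt <= dV T s (act A (c i) s))%R).
  { intro i. eapply Rle_trans; [|apply tl_le_displacement].
    (* [minR] starts its fold with the head of the list, so the first translation length enters
       twice. *)
    unfold mt, minR. simpl. destruct i; simpl; [apply Rmin_l|].
    eapply Rle_trans; [apply Rmin_r|apply Rmin_l]. }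
  assert (N11 : INR 11 = 11%R) by (simpl; lra). rewrite N11 in *.
  (* Displacements exceed 11 but are at most 12/11 of [mt]. *)
  assert (Pos : (0 < mt)%R).
  { assert (F := Far 0 ltac:(lia)). assert (N := Near 0 ltac:(lia)).
    assert (11 < (11 + 1) / 11 * mt)%R by lra. lra. }
  (* With [k] the integer part of [mt / 11], an overlap longer than [k] reaches the threshold of the
     overlap clause. *)
  destruct (floor_nat (mt / 11)) as (k & K1 & K2); [lra|].
  assert (Long : forall i, 11 * k <= Defs.dist T s (act A (c i) s)).
  { intro i. apply INR_le. rewrite mult_INR, N11. specialize (Hm i). unfold dV in Hm. lra. }
  exists s, k. split.
  - intros i j g p q p' q' S1 S2 S1' S2' E1 E2 L.
    destruct (Overlap g (n i) (n j) (Hn i) (Hn j)) as [E F].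
    + rewrite !Ec. exists p, q. split; [split; eauto|split; [split; eauto|]].
      apply Rle_trans with (INR (S k)); [rewrite S_INR; lra|]. apply le_INR. lia.
    + assert (i = j) as <- by (destruct i, j; simpl in E; congruence).
      split; auto. rewrite Ec in F.
      split; eapply (act_inj G T A g); [rewrite <- E1|rewrite <- E2]; apply F; eauto.
  (* For positive [k], 11k exceeds 4k; for [k = 0] the displacement only has to be positive. *)
  - intro i. specialize (Long i). fold (c i).
    assert (0 < Defs.dist T s (act A (c i) s)); [|lia].
    apply INR_lt. specialize (Hm i). unfold dV in Hm. simpl. lra.
Qed.

(** * The free group of rank two *)

Definition inv_letter (x : letter) : letter := (fst x, negb (snd x)).

Lemma cancels_true x y : cancels x y = true <-> y = inv_letter x.
Proof.
  destruct x as [[] []], y as [[] []]; unfold cancels, inv_letter; simpl; split; congruence.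
Qed.

Lemma inv_letterK x : inv_letter (inv_letter x) = x.
Proof. destruct x as [[] []]; reflexivity. Qed.

Fixpoint reduced (w : list letter) : Prop :=
  match w with
  | x :: ((y :: _) as r) => cancels x y = false /\ reduced r
  | _ => True
  end.

Lemma reduce_id w : reduced w -> reduce w = w.
Proof.
  induction w as [|x [|y w] IH]; auto. intros [C R].
  change (rstep x (reduce (y :: w)) = x :: y :: w). rewrite IH by auto. simpl. now rewrite C.
Qed.

Lemma rstep_reduced x w : reduced w -> reduced (rstep x w).
Proof.
  destruct w as [|y w]; simpl; auto. destruct (cancels x y) eqn:C; intro R.
  - destruct w; simpl in *; tauto.
  - split; auto.
Qed.

Lemma reduce_reduced w : reduced (reduce w).
Proof. induction w; [exact I|]. now apply rstep_reduced. Qed.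

(** Letters act on reduced words by permutations, inverse letters by inverse permutations; the group
    laws for normal forms follow without a confluence argument. *)
Lemma rstep_inv x w : reduced w -> rstep x (rstep (inv_letter x) w) = w.
Proof.
  assert (C : cancels x (inv_letter x) = true) by now apply cancels_true.
  destruct w as [|y w]; simpl; [now rewrite C|].
  destruct (cancels (inv_letter x) y) eqn:E.
  - apply cancels_true in E. rewrite inv_letterK in E. subst y. intro R.
    destruct w as [|z w]; simpl in *; auto. now destruct R as [-> _].
  - intros _. simpl. now rewrite C.
Qed.

Lemma reduce_app u v : reduce (u ++ v) = fold_right rstep (reduce v) u.
Proof. apply fold_right_app. Qed.

Lemma reduce_app_r u v : reduce (u ++ reduce v) = reduce (u ++ v).
Proof. rewrite !reduce_app, (reduce_id (reduce v)); auto using reduce_reduced. Qed.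

Lemma reduce_app_l u v : reduce (reduce u ++ v) = reduce (u ++ v).
Proof.
  induction u as [|x u IH]; auto. simpl. fold (reduce u) (reduce (u ++ v)). rewrite <- IH.
  destruct (reduce u) as [|y r]; auto. simpl rstep at 1.
  destruct (cancels x y) eqn:C; auto.
  apply cancels_true in C. subst y. symmetry. apply rstep_inv, reduce_reduced.
Qed.

Lemma reduce_inv_l w : reduce (F2inv w ++ w) = [].
Proof.
  induction w as [|x w IH]; auto. unfold F2inv in *. simpl. fold (inv_letter x).
  rewrite <- app_assoc, reduce_app. simpl. fold (reduce w).
  replace (rstep x (reduce w)) with (rstep (inv_letter (inv_letter x)) (reduce w))
    by now rewrite inv_letterK.
  rewrite rstep_inv by apply reduce_reduced. now rewrite <- reduce_app.
Qed.

(** Normal forms turn [F2eq] into Leibniz equality, as [Group] requires; decidability of equality on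
    words makes the proof component unique. *)
Definition F2car := {w : list letter | reduce w = w}.

Definition normal (w : list letter) : F2car :=
  exist _ (reduce w) (reduce_id _ (reduce_reduced w)).

Definition word (x : F2car) : list letter := proj1_sig x.

Lemma letter_list_eq_dec (u v : list letter) : {u = v} + {u <> v}.
Proof. repeat decide equality. Defined.

Lemma word_inj x y : word x = word y -> x = y.
Proof.
  destruct x as [u E], y as [v F]; simpl; intros <-. f_equal. apply UIP_dec, letter_list_eq_dec.
Qed.

Lemma normal_word x : normal (word x) = x.
Proof. apply word_inj. exact (proj2_sig x). Qed.

Definition F2 : Group.
Proof.
  refine {| gcar := F2car; gmul x y := normal (word x ++ word y);
            ginv x := normal (F2inv (word x)); gone := normal [] |}.
  - intros x y z. apply word_inj. simpl.
    now rewrite reduce_app_r, reduce_app_l, app_assoc.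
  - intros x. apply word_inj. simpl. exact (proj2_sig x).
  - intros x. apply word_inj. simpl. rewrite reduce_app_l. apply reduce_inv_l.
Defined.

Lemma normal_app u v : normal (u ++ v) = gmul F2 (normal u) (normal v).
Proof. apply word_inj. simpl. now rewrite reduce_app_r, reduce_app_l. Qed.

Lemma normal_inv u : normal (F2inv u) = ginv F2 (normal u).
Proof.
  assert (E : (normal u : F2) = ginv F2 (normal (F2inv u))).
  { apply (ginv_unique F2). rewrite <- normal_app. apply word_inj. simpl. now rewrite reduce_inv_l. }
  rewrite E. symmetry. apply (ginvK F2).
Qed.

Lemma normal_tval e t :
  normal (tval (list letter) (@app letter) F2inv [] e t) =
  tval F2 (gmul F2) (ginv F2) (gone F2) (fun n => normal (e n)) t.
Proof.
  induction t as [n| |t1 IH1 t2 IH2|t IH]; simpl tval; auto.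
  - now rewrite normal_app, IH1, IH2.
  - now rewrite normal_inv, IH.
Qed.

Lemma sat_normal f : forall e,
  sat (list letter) (@app letter) F2inv [] F2eq e f <->
  sat F2 (gmul F2) (ginv F2) (gone F2) eq (fun n => normal (e n)) f.
Proof.
  induction f as [t1 t2|f1 IH1 f2 IH2|f1 IH1 f2 IH2|n f IH|n f IH]; simpl; intro e.
  - rewrite <- !normal_tval. unfold F2eq. split; intro E.
    + now apply word_inj.
    + now injection E.
  - now rewrite IH1, IH2.
  - now rewrite IH1, IH2.
  - split; intros E x.
    + rewrite <- (normal_word x). specialize (E (word x)). rewrite IH in E.
      now rewrite (upd_comp _ F2 normal) in E.
    + rewrite IH, (upd_comp _ F2 normal). apply E.
  - split; intros [x E].
    + exists (normal x). rewrite IH in E. now rewrite (upd_comp _ F2 normal) in E.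
    + exists (word x). rewrite IH, (upd_comp _ F2 normal), normal_word. exact E.
Qed.

Lemma F2Holds_iff f : F2Holds f <-> GHolds F2 f.
Proof. apply sat_normal. Qed.

(** * The Cayley tree of [F2] *)

Definition gen (x : letter) : F2 := normal [x].

Lemma gen_inv x : gen (inv_letter x) = ginv F2 (gen x).
Proof.
  apply ginv_unique. unfold gen. rewrite <- normal_app. apply word_inj. simpl.
  replace (cancels x (inv_letter x)) with true; auto. symmetry. now apply cancels_true.
Qed.

Lemma normal_cons x w : normal (x :: w) = gmul F2 (gen x) (normal w).
Proof. exact (normal_app [x] w). Qed.

Definition F2_tree : Tree.
Proof.
  refine {| vert := F2; adj u v := exists x, v = gmul F2 u (gen x) |}.
  - intros u v [x ->]. exists (inv_letter x). rewrite gen_inv. now rewrite <- gmulA, gmulrV, gmulr1.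
  - intros u [x E]. rewrite <- (gmulr1 F2 u) in E at 1. apply gmul_injl in E.
    apply (f_equal word) in E. discriminate.
Defined.

Definition F2_action : Action F2 F2_tree.
Proof.
  refine {| act := (gmul F2 : F2 -> vert F2_tree -> vert F2_tree) |}.
  - apply gmul1.
  - intros g h v. symmetry. apply gmulA.
  - intros g u v. split; intros [x E]; exists x.
    + now rewrite E, gmulA.
    + rewrite <- gmulA in E. now apply gmul_injl in E.
Defined.

Lemma F2_walk w : forall u, Walk F2_tree u (gmul F2 u (normal w)) (length w).
Proof.
  induction w as [|x w IH]; intro u; cbn [length].
  - change (normal []) with (gone F2). rewrite gmulr1. constructor.
  - apply wcons with (gmul F2 u (gen x)); [now exists x|].
    rewrite normal_cons, gmulA. apply IH.
Qed.

Fixpoint trace (u : F2) (w : list letter) : list F2 :=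
  match w with [] => [] | x :: w => gmul F2 u (gen x) :: trace (gmul F2 u (gen x)) w end.

Lemma chain_trace l : forall u, chain F2_tree (u :: l) -> exists w, l = trace u w.
Proof.
  induction l as [|v l IH]; intros u C.
  - now exists [].
  - destruct C as [[x ->] C]. destruct (IH _ C) as [w ->]. now exists (x :: w).
Qed.

Lemma trace_reduced w : forall u, nobacktrack F2_tree (u :: trace u w) -> reduced w.
Proof.
  induction w as [|x [|y w] IH]; intros u B; [exact I|exact I|].
  destruct B as [Hne B]. split; [|exact (IH _ B)].
  destruct (cancels x y) eqn:C; auto. exfalso. apply Hne.
  apply cancels_true in C. subst y. rewrite gen_inv. now rewrite <- gmulA, gmulrV, gmulr1.
Qed.

Lemma last_trace w : forall u d, last (trace u w) u = gmul F2 u (normal w) /\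
  (w <> [] -> last (trace u w) d = gmul F2 u (normal w)).
Proof.
  induction w as [|x w IH]; intros u d.
  - split; [|congruence]. symmetry. apply gmulr1.
  - assert (E : forall d', last (trace u (x :: w)) d' = gmul F2 u (normal (x :: w))).
    { intro d'. rewrite normal_cons, gmulA. destruct w as [|y w].
      - symmetry. apply gmulr1.
      - destruct (IH (gmul F2 u (gen x)) d') as [_ X]. apply X. discriminate. }
    auto.
Qed.

(** A path is given by its starting point and its word of labels. Without backtracking the label
    word is reduced, and if the path closes up the word is trivial in [F2], hence empty. *)
Lemma F2_is_tree : is_tree F2_tree.
Proof.
  split.
  - intros u v. exists (length (word (gmul F2 (ginv F2 u) v))).
    assert (W := F2_walk (word (gmul F2 (ginv F2 u) v)) u).
    now rewrite normal_word, gmulVK in W.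
  - intros u l C B E. destruct (chain_trace l u C) as [w ->].
    destruct (last_trace w u u) as [X _].
    assert (E' : gmul F2 u (normal w) = u) by exact (eq_trans (eq_sym X) E).
    rewrite <- (gmulr1 F2 u) in E' at 2. apply gmul_injl in E'.
    apply (f_equal word) in E'. simpl in E'.
    rewrite reduce_id in E' by now apply (trace_reduced w u). now rewrite E'.
Qed.

Lemma F2_edge i : Defs.dist F2_tree (gone F2) (act F2_action (gen (i, false)) (gone F2)) = 1.
Proof.
  apply tdist_adj; [exact F2_is_tree|]. exists (i, false).
  exact (eq_trans (gmulr1 F2 _) (eq_sym (gmul1 F2 _))).
Qed.

(** The segments are single edges, so a positive overlap is a whole edge. Left translation preserves
    labels, and it cannot reverse an edge because a product of two positive generators is never
    trivial. *)
Lemma F2_short_overlaps :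
  short_overlaps F2 F2_tree F2_action (gone F2) (fun i => gen (i, false)) 0.
Proof.
  assert (V : forall i z, inseg F2_tree (gone F2) (act F2_action (gen (i, false)) (gone F2)) z ->
    z = gone F2 \/ z = gen (i, false)).
  { intros i z S. unfold inseg in S. rewrite F2_edge in S.
    destruct (Defs.dist F2_tree (gone F2) z) eqn:E.
    - left. symmetry. now apply (tdist0_eq _ F2_is_tree) in E.
    - right. rewrite (tdist0_eq _ F2_is_tree z (act F2_action (gen (i, false)) (gone F2)));
        [exact (gmulr1 F2 _)|lia]. }
  assert (P : forall i j, gmul F2 (gen (i, false)) (gen (j, false)) <> gone F2).
  { intros i j E. apply (f_equal word) in E. destruct i, j; discriminate. }
  intros i j g p q p' q' S1 S2 S1' S2' E1 E2 L.
  assert (Hne : p <> q).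
  { intros ->. rewrite (tdist_refl _ F2_is_tree) in L. lia. }
  assert (Hne' : p' <> q') by congruence.
  change (p = gmul F2 g p') in E1. change (q = gmul F2 g q') in E2.
  assert (J : gen (i, false) = gen (j, false) -> i = j).
  { intro E. apply (f_equal word) in E. now injection E. }
  destruct (V _ _ S1) as [Hp|Hp], (V _ _ S2) as [Hq|Hq],
    (V _ _ S1') as [Hp'|Hp'], (V _ _ S2') as [Hq'|Hq']; try congruence;
    rewrite Hp, Hp' in E1; rewrite Hq, Hq' in E2; try rewrite (gmulr1 F2) in E1; try rewrite (gmulr1 F2) in E2.
  - rewrite <- E1, (gmul1 F2) in E2. apply J in E2 as ->. repeat split; congruence.
  - exfalso. apply (P i j). congruence.
  - exfalso. apply (P i j). congruence.
  - rewrite <- E2, (gmul1 F2) in E1. apply J in E1 as ->. repeat split; congruence.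
Qed.

Lemma F2_encodable M : encodable F2_action (gone F2) M.
Proof.
  apply (short_overlaps_encodable F2 F2_tree F2_action _ (fun i => gen (i, false)) 0).
  - exact F2_is_tree.
  - exact F2_short_overlaps.
  - intro i. rewrite F2_edge. lia.
Qed.

Theorem theoremD (G : Group) (T : Tree) (A : Action G T) :
  is_tree T ->
  irreducible_action A ->
  minimal_action A ->
  (forall N m : nat, (1 <= N)%nat -> (1 <= m)%nat ->
     exists a : list G, length a = m /\ weak_small_cancellation A N a) ->
  trivial_positive_theory G.
Proof.
  intros HT _ _ SC f _. rewrite F2Holds_iff.
  (* Two elements suffice to build the coding words, and 11 makes their displacement large against
     the overlap bound. *)
  destruct (SC 11 2) as (l & E & W); [lia|lia|].
  destruct l as [|a [|b [|]]]; try discriminate.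
  destruct (small_cancellation_short_overlaps G T A a b HT W) as (s & k & SO & Long).
  (* In each direction the sentence is transferred to all groups, from [G] acting on [T] or from
     [F2] acting on its Cayley tree. *)
  split; intro Hf.
  - apply (encodable_transfer G T A s HT); auto.
    exact (short_overlaps_encodable G T A s _ k HT SO Long).
  - exact (encodable_transfer F2 F2_tree F2_action _ F2_is_tree F2_encodable f Hf G).
Qed.
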